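(* Let $d\ge2$, let $Q\in l_1(\mathbb{Z})$ be a strictly positive even function (transfer operator), let $q\ge2$, and let $\lambda_q$ be a height-periodic boundary law for $Q$ with minimal period $q$. For $m\ge2$ let $\Delta^m\subset\mathbb{R}^m$ be the $(m-1)$-dimensional standard simplex, and call $u,v\in\Delta^m$ equivalent ($u\sim v$) iff $u=v\circ\rho$ for some cyclic permutation of coordinates $\rho$. Consider any infinite path of edges $b_1,b_2,\ldots$ of the Cayley tree $\Gamma^d$ and, for the gradient field distributed according to $\nu^{\lambda_q}$, the height-field along this path defined by prescribing a fixed height at some vertex of the path. Then for any $\tilde q\in\{2,3,\ldots\}$ the empirical distribution of the mod-$\tilde q$ projections of the heights along the path converges almost surely to a deterministic limit $(\alpha_{\tilde q}(0),\ldots,\alpha_{\tilde q}(\tilde q-1))\in\Delta^{\tilde q}/\!\sim$. The minimal period $q$ can be recovered as the greatest common divisor of all $\tilde q\in\{2,3,\ldots\}$ with the property that $\tilde\lambda_{\tilde q}=(\alpha_{\tilde q}(0)^{\frac{d}{d+1}},\ldots,\alpha_{\tilde q}(\tilde q-1)^{\frac{d}{d+1}})$ is a $\tilde q$-periodic boundary law for $Q$ and $\nu^{\tilde\lambda_{\tilde q}}=\nu^{\lambda_q}$.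
   Context: The Cayley tree $\Gamma^d=(V,L)$ of order $d$ is the infinite connected graph without cycles in which every vertex has exactly $d+1$ neighbours; $\vec L$ denotes the set of oriented edges. An infinite path is $b_i=(x_{i-1},x_i)$, $i\ge1$, with consecutive neighbours and pairwise distinct vertices; the height field along it is obtained by summing the gradient variables $\eta_{b_i}$ from the prescribed height. Periodic boundary laws. A (spatially homogeneous) $q$-periodic boundary law for $Q$ is a $q$-periodic function $\lambda_q:\mathbb{Z}\to(0,\infty)$ for which there is $c>0$ with $\lambda_q(i)=c\big(\sum_{j\in\mathbb{Z}}Q(i-j)\lambda_q(j)\big)^d$ for all $i\in\mathbb{Z}$; it is identified with a function on $\mathbb{Z}_q=\mathbb{Z}/q\mathbb{Z}$, i.e. a vector $(\lambda_q(0),\dots,\lambda_q(q-1))$. Put $Q_q(\bar s)=\sum_{l\in\bar s}Q(l)$ for $\bar s\in\mathbb{Z}_q$. The gradient Gibbs measure $\nu^{\lambda_q}$. Gradient configurations are $\zeta\in\mathbb{Z}^{\vec L}$ with $\zeta_{(x,y)}=-\zeta_{(y,x)}$ (for heights $\omega$, $\zeta_{(x,y)}=\omega_y-\omega_x$). Let $P'_q(\bar i,\bar j)=\frac{Q_q(\bar i-\bar j)\lambda_q(\bar j)}{\sum_{\bar s\in\mathbb{Z}_q}Q_q(\bar i-\bar s)\lambda_q(\bar s)}$, a transition matrix on $\mathbb{Z}_q$ with reversible stationary distribution $\alpha(\bar i)=\lambda_q(\bar i)^{\frac{d+1}{d}}/\sum_{\bar j\in\mathbb{Z}_q}\lambda_q(\bar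 j)^{\frac{d+1}{d}}$. Let $P^{\lambda_q,\mathrm{f.c.}}$ be the law on $\mathbb{Z}_q^V$ of the stationary tree-indexed Markov chain $\sigma'$: for finite connected $\Lambda\ni w$, $P^{\lambda_q,\mathrm{f.c.}}(\sigma'_\Lambda)=\alpha(\sigma'_w)\prod P'_q(\sigma'_x,\sigma'_y)$, the product over edges $(x,y)$ in $\Lambda$ oriented away from $w$. Let $\rho^Q_q(j\mid\bar s)=\mathbf 1(j\in\bar s)\,Q(j)/Q_q(\bar s)$. Then $\nu^{\lambda_q}$ is the probability measure on gradient configurations $\eta$ with marginals, for finite connected $\Lambda\subset V$, $$\nu^{\lambda_q}(\eta_\Lambda=\zeta_\Lambda)=\sum_{\sigma'_\Lambda\in\mathbb{Z}_q^\Lambda}P^{\lambda_q,\mathrm{f.c.}}(\sigma'_\Lambda)\prod_{(x,y)}\rho^Q_q(\zeta_{(x,y)}\mid\sigma'_y-\sigma'_x),$$ the product over the edges inside $\Lambda$, each taken in one orientation. A cyclic permutation of coordinates of a vector indexed by $\mathbb{Z}_m$ is a shift $\bar k\mapsto\bar k+\bar a$; the properties ''is a $\tilde q$-periodic boundary law'' and the measure $\nu^{\tilde\lambda_{\tilde q}}$ do not depend on the chosen representative of the equivalence class. *)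

(* Defs.v *)
(* Z/mZ is the ring 'Z_m, and the residue of an integer i is i%:~R : 'Z_m.  This
   reading is correct only for m >= 2 ('Z_0 and 'Z_1 both denote Z/2Z). *)
From HB Require Import structures.
From mathcomp Require Import all_boot all_order all_algebra.
From mathcomp Require Import finmap.
From mathcomp Require Import all_classical all_reals all_analysis.

Set Implicit Arguments.
Unset Strict Implicit.
Unset Printing Implicit Defensive.

Import Order.TTheory GRing.Theory Num.Theory.
Import numFieldNormedType.Exports.

Local Open Scope classical_set_scope.
Local Open Scope ring_scope.

Section tree.
Context {V : choiceType}.
Implicit Types (adj : rel V) (L : {fset V}).

Definition connected_graph adj : Prop :=
  forall x y, exists2 p, path adj x p & last x p = y.

(* [ucycle adj p]: p is a closed walk through pairwise distinct vertices; those
   of size at most 2 only run back and forth along one edge. *)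
Definition acyclic_graph adj : Prop :=
  forall p, ucycle adj p -> (size p <= 2)%N.

Definition regular_graph adj (k : nat) : Prop :=
  forall x, exists2 N : {fset V}, #|` N| = k & forall y, (y \in N) = adj x y.

Definition cayley_tree adj (d : nat) : Prop :=
  [/\ irreflexive adj, symmetric adj, infinite_set [set: V],
      connected_graph adj & acyclic_graph adj /\ regular_graph adj d.+1].

Definition connected_in adj L : Prop :=
  forall x y, x \in L -> y \in L ->
    exists p, [/\ path adj x p, {subset p <= L} & last x p = y].

(* (x, y) is the last edge of a self-avoiding path issued from w. *)
Definition away_from adj (w x y : V) : Prop :=
  exists p, [/\ path adj w (rcons p y), uniq (w :: rcons p y) & last w p = x].

Definition infinite_path adj (b : nat -> V) : Prop :=
  (forall n, adj (b n) (b n.+1)) /\ injective b.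

(* An element of Z^(oriented edges), antisymmetric under edge reversal, encoded
   as a function on all pairs of vertices that is 0 off the edges. *)
Definition gradients adj : set (V -> V -> int) :=
  [set z | (forall x y, z x y = - z y x) /\ (forall x y, ~~ adj x y -> z x y = 0)].

Lemma zero_gradient adj : (fun _ _ : V => 0) \in gradients adj.
Proof. by rewrite inE; split=> // x y; rewrite oppr0. Qed.

Definition gradient_config adj : Type := gradients adj.
HB.instance Definition _ adj := Choice.copy (gradient_config adj) (gradients adj).
HB.instance Definition _ adj := isPointed.Build (gradient_config adj)
  (exist _ (fun _ _ => 0) (zero_gradient adj)).

Definition gval adj (eta : gradient_config adj) : V -> V -> int := set_val eta.

Definition coordinate_events adj : set (set (gradient_config adj)) :=
  [set A | exists x y n, A = [set eta | gval eta x y = n]].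

Definition gradient_space adj := g_sigma_algebraType (@coordinate_events adj).
HB.instance Definition _ adj := Measurable.on (gradient_space adj).

Definition cylinder adj L (zeta : gradient_config adj) : set (gradient_space adj) :=
  [set eta | forall x y, x \in L -> y \in L -> gval eta x y = gval zeta x y].

End tree.

Section boundary_law.
Context {R : realType}.
Implicit Types (Q : int -> R) (lam : int -> R) (d q : nat).

Definition transfer_operator Q : Prop :=
  [/\ forall i, 0 < Q i, forall i, Q (- i) = Q i & summable [set: int] (EFin \o Q)].

Definition periodic lam q : Prop := forall i, lam (i + q%:Z) = lam i.

Definition minimal_period lam q : Prop :=
  [/\ (0 < q)%N, periodic lam q &
      forall p, (0 < p)%N -> periodic lam p -> (q <= p)%N].

Definition periodic_boundary_law d Q q lam : Prop :=
  [/\ periodic lam q, forall i, 0 < lam i &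
      exists2 c : R, 0 < c & forall i,
        (lam i)%:E = (c%:E * (\esum_(j in [set: int]) (Q (i - j) * lam j)%:E) ^+ d)%E].

Definition unfold_Z q (l : 'Z_q -> R) : int -> R := fun i => l i%:~R.

End boundary_law.

Section gradient_gibbs_measure.
Context {R : realType} {V : choiceType} (adj : rel V).
Variables (d : nat) (Q : int -> R) (q : nat) (l : 'Z_q -> R).

Definition fuzzy_Q (s : 'Z_q) : R :=
  fine (\esum_(k in [set k : int | k%:~R = s :> 'Z_q]) (Q k)%:E).

Definition fuzzy_transition (i j : 'Z_q) : R :=
  fuzzy_Q (i - j) * l j / \sum_(s : 'Z_q) fuzzy_Q (i - s) * l s.

Definition fuzzy_stationary (i : 'Z_q) : R :=
  l i `^ (d.+1%:R / d%:R) / \sum_(j : 'Z_q) l j `^ (d.+1%:R / d%:R).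

Definition increment_law (j : int) (s : 'Z_q) : R :=
  (j%:~R == s)%:R * (Q j / fuzzy_Q s).

(* The product runs over the edges of L oriented away from w.  By reversibility
   the value does not depend on w when l is a boundary law. *)
Definition fuzzy_chain_law (L : {fset V}) (w : L) (sigma : {ffun L -> 'Z_q}) : R :=
  fuzzy_stationary (sigma w) *
  \prod_(e : L * L | `[< away_from adj (fsval w) (fsval e.1) (fsval e.2) >])
    fuzzy_transition (sigma e.1) (sigma e.2).

(* A probability nu with these marginals on all finite connected L is unique: it
   is the gradient Gibbs measure of l.  In the last product each edge is taken in
   the orientation away from w; for Q even this choice is irrelevant. *)
Definition gradient_gibbs (nu : set (gradient_space adj) -> \bar R) : Prop :=
  forall (L : {fset V}) (w : L) (zeta : gradient_config adj), connected_in adj L ->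
    nu (cylinder L zeta) =
    (\sum_(sigma : {ffun L -> 'Z_q}) fuzzy_chain_law w sigma *
       \prod_(e : L * L | `[< away_from adj (fsval w) (fsval e.1) (fsval e.2) >])
         increment_law (gval zeta (fsval e.1) (fsval e.2)) (sigma e.2 - sigma e.1))%:E.

End gradient_gibbs_measure.

Section cyclic_simplex.
Context {R : realType}.

(* Coordinates are indexed by 'Z_m, which unfolds to 'I_(Zp_trunc m).+2. *)
Definition simplex (m : nat) : set 'rV[R]_(Zp_trunc m).+2 :=
  [set u | (forall s, 0 <= u 0 s) /\ \sum_s u 0 s = 1].
Arguments simplex : clear implicits.

Definition cyclic_equiv (m : nat) (u v : simplex m) : bool :=
  `[< exists a : 'Z_m, forall s : 'Z_m, set_val u 0 s = set_val v 0 (s + a) >].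

Lemma cyclic_equiv_refl m : reflexive (@cyclic_equiv m).
Proof. by move=> u; apply/asboolP; exists 0 => s; rewrite addr0. Qed.

Lemma cyclic_equiv_sym m : symmetric (@cyclic_equiv m).
Proof.
have H u v : @cyclic_equiv m u v -> cyclic_equiv v u.
  move=> /asboolP[a uv]; apply/asboolP; exists (- a) => s.
  by rewrite uv subrK.
by move=> u v; apply/idP/idP; exact: H.
Qed.

Lemma cyclic_equiv_trans m : transitive (@cyclic_equiv m).
Proof.
move=> v u w /asboolP[a uv] /asboolP[b vw]; apply/asboolP; exists (a + b) => s.
by rewrite uv vw addrA.
Qed.

Canonical cyclic_equiv_rel m := EquivRel (@cyclic_equiv m)
  (@cyclic_equiv_refl m) (@cyclic_equiv_sym m) (@cyclic_equiv_trans m).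

Definition cyclic_simplex (m : nat) :=
  quotient_topology {eq_quot @cyclic_equiv_rel m}%qT.
HB.instance Definition _ m := Topological.on (cyclic_simplex m).

Definition cyclic_class (m : nat) (u : simplex m) : cyclic_simplex m :=
  (\pi_{eq_quot @cyclic_equiv_rel m} u)%qT.

Lemma empirical_in_simplex (m : nat) (H : nat -> int) (n : nat) :
  \row_(s < (Zp_trunc m).+2)
     ((\sum_(i < n.+1) ((H i)%:~R == s :> 'Z_m)%:R) / n.+1%:R) \in simplex m.
Proof.
rewrite inE; split=> [s|].
  by rewrite mxE divr_ge0 ?ler0n// sumr_ge0// => i _; rewrite ler0n.
under eq_bigr do rewrite mxE; rewrite -mulr_suml exchange_big /=.
under eq_bigr => i _.
  rewrite (bigD1 ((H i)%:~R : 'Z_m))//= eqxx big1 ?addr0; last first.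
    by move=> s /negPf; rewrite eq_sym => ->.
  over.
by rewrite sumr_const card_ord divff// pnatr_eq0.
Qed.

Definition empirical (m : nat) (H : nat -> int) (n : nat) : simplex m :=
  exist (fun u => u \in simplex m) _ (empirical_in_simplex m H n).

End cyclic_simplex.

Arguments simplex R m _ : clear implicits.
Arguments cyclic_simplex R m : clear implicits.

(* The height at the n-th vertex, normalised to be h at the k-th one. *)
Definition path_height {V : choiceType} {adj : rel V} (b : nat -> V) (k : nat)
    (h : int) (eta : gradient_config adj) (n : nat) : int :=
  h + \sum_(i < n) gval eta (b i) (b i.+1) - \sum_(i < k) gval eta (b i) (b i.+1).

Definition empirical_limit {R : realType} {V : choiceType} {adj : rel V}
    (nu : {measure set (gradient_space adj) -> \bar R}) (b : nat -> V) (k : nat)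
    (h : int) (m : nat) (u : cyclic_simplex R m) : Prop :=
  {ae nu, forall eta,
    cyclic_class (empirical m (path_height b k h eta) n) @[n --> \oo] --> u}.

Definition tilde_law {R : realType} (d m : nat) (u : simplex R m) : 'Z_m -> R :=
  fun s => set_val u 0 s `^ (d%:R / d.+1%:R).

Definition is_gcd (S : set nat) (g : nat) : Prop :=
  (forall m, S m -> (g %| m)%N) /\
  (forall c : nat, (forall m, S m -> (c %| m)%N) -> (c %| g)%N).

(* Main.v *)
Require Import Defs.
From mathcomp Require Import all_boot all_order all_algebra.
From mathcomp Require Import finmap.
From mathcomp Require Import all_classical all_reals all_analysis.
From mathcomp Require Import ring lra zify.

(** Along the path the heights form a random walk on the integers.  Given the class
    [s] of the initial height modulo [q], the increments are those of the Markov
    chain that jumps from [i] to [i + x] with probability proportional to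
    [Q x * lam (i + x)] (lemma [gibbs_path_cylinder]); the measure is the mixture
    of these laws over [s].  That the cylinder on a segment of the path involves
    exactly its consecutive edges is where the tree structure enters
    ([away_from_pathE]).

    Let [M] be a multiple of [q].  Since [lam] is [M]-periodic, the chain projects
    to a Markov chain on ['Z_M] with positive transition probabilities.  The
    boundary law equation makes it reversible with respect to the normalised
    power [lam ^ ((d + 1) / d)] ([fuzzy_reversible]), which is therefore its
    stationary distribution.  Occupation frequencies concentrate exponentially
    fast around it: a function of mean zero has the form [g - P g]
    ([poisson_equation]), so its sum along a trajectory is a sum of centred
    increments, which is controlled by exponential moments ([path_sum_large],
    [occupation_large]).  Borel-Cantelli then gives the almost sure convergence of
    the empirical distribution modulo [M], up to the unknown shift by the initial
    height ([empirical_orbit_cvg]); the limit class does not depend on that shift.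

    For an arbitrary modulus [m], take [M = q * m] and push the limit forward from
    ['Z_M] to ['Z_m] ([orbit_cvg_reduce]).  Convergence of classes is convergence up
    to shifts, with a unique limit ([cvg_cyclic_classP], [orbit_cvg_unique]).

    At [m = q] the limit is the normalised [lam ^ ((d + 1) / d)] up to a shift, so the
    law reconstructed from it is a shift of a multiple of [lam]; it is a boundary
    law with the same gradient Gibbs measure ([boundary_law_affine],
    [gradient_gibbs_affine]).  So [q] belongs to the set of admissible moduli.
    Conversely, if [m] is admissible, the reconstructed [m]-periodic law and [lam]
    have the same measure, hence the same empirical limit modulo [q * m], so that
    [lam] is a shift of a multiple of an [m]-periodic function
    ([gibbs_common_period]), and [q] divides [m] by minimality.  Hence [q] is the
    greatest common divisor. *)

Set Implicit Arguments.
Unset Strict Implicit.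
Unset Printing Implicit Defensive.

Import Order.TTheory GRing.Theory Num.Theory.
Import numFieldNormedType.Exports.

Local Open Scope classical_set_scope.
Local Open Scope ring_scope.

(** * Paths in trees *)

Section tree_paths.
Context {V : choiceType} (adj : rel V) (b : nat -> V).
Hypothesis irr_adj : irreflexive adj.
Hypothesis sym_adj : symmetric adj.
Hypothesis acyc : acyclic_graph adj.
Hypothesis bP : infinite_path adj b.

Let segment i n := [seq b k | k <- iota i n].

Lemma path_segment i n : path adj (b i) (segment i.+1 n).
Proof. by elim: n i => //= n IH i; rewrite bP.1 /=. Qed.

Lemma last_segment i n : last (b i) (segment i.+1 n) = b (i + n)%N.
Proof. by elim: n i => [|n IH] i /=; rewrite ?addn0 // IH addSnnS. Qed.

Lemma uniq_segment i n : uniq (segment i n).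
Proof. by rewrite map_inj_uniq ?iota_uniq//; exact: bP.2. Qed.

(** A chord would close the segment between its ends into a cycle. *)
Lemma path_chordless i n : ~~ adj (b i) (b (i + n.+2)%N).
Proof.
apply/negP => adj_chord.
have : ucycle adj (b i :: segment i.+1 n.+2).
  apply/andP; split; last exact: (uniq_segment i n.+3).
  by rewrite /cycle rcons_path path_segment last_segment sym_adj.
by move=> /acyc; rewrite /= size_map size_iota.
Qed.

Lemma path_adjE i j : adj (b i) (b j) = (j == i.+1) || (i == j.+1).
Proof.
apply/idP/idP => [|/orP[]/eqP->]; last 2 first.
- exact: bP.1.
- by rewrite sym_adj; exact: bP.1.
have chord u v : adj (b u) (b v) -> (u < v)%N -> v = u.+1.
  move=> uv ltuv; apply/eqP; apply: contraTT uv => neq.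
  have -> : v = (u + (v - u - 2).+2)%N by lia.
  exact: path_chordless.
move=> ij; have [lt|lt|eqij] := ltngtP i j.
- by rewrite (chord i j)// eqxx.
- by rewrite (chord j i) ?eqxx ?orbT // sym_adj.
- by move: ij; rewrite eqij irr_adj.
Qed.

(** A self-avoiding walk cannot enter [b j] from [b j.+1]: together with the
    beginning of the path it would join the two neighbours [b j.-1] and [b j.+1]
    of [b j] outside [b j], and hence close a cycle through [b j]. *)
Lemma away_from_pathE i j :
  `[< away_from adj (b 0) (b i) (b j) >] = (j == i.+1).
Proof.
apply/idP/eqP => [/asboolP[p [pp up lastp]]|->]; last first.
  apply/asboolP; exists (segment 1 i); split.
  - rewrite rcons_path path_segment last_segment add0n; exact: bP.1.
  - have -> : rcons (segment 1 i) (b i.+1) = segment 1 i.+1.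
      by rewrite /segment -(addn1 i) iotaD map_cat cats1 add1n addn1.
    exact: (uniq_segment 0 i.+2).
  - by rewrite last_segment.
move: (pp); rewrite rcons_path lastp path_adjE => /andP[pathp /orP[/eqP//|/eqP ei]].
subst i; exfalso.
case: j pp up lastp => [|j] pp up lastp.
  by move: up; rewrite /= mem_rcons in_cons eqxx.
have bjp : b j.+1 \notin b 0 :: p.
  move: up; rewrite -rcons_cons rcons_uniq => /andP[] //.
(* Go back along the path from [b j] to [b 0], then follow the walk [p]. *)
have last_back : last (b j) (rev (belast (b 0) (segment 1 j))) = b 0.
  by case: j {pp up lastp bjp} => //= j; rewrite rev_cons last_rcons.
pose r := rev (belast (b 0) (segment 1 j)) ++ p.
have pathr : path adj (b j) r.
  rewrite cat_path last_back pathp andbT -{1}(last_segment 0 j) rev_path.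
  by have := path_segment 0 j; rewrite (eq_path (fun x y => sym_adj x y)).
have lastr : last (b j) r = b j.+2 by rewrite /r last_cat last_back.
have rj : b j.+1 \notin b j :: r.
  rewrite inE mem_cat mem_rev !negb_or.
  move: bjp; rewrite inE negb_or => /andP[_ ->]; rewrite andbT.
  apply/andP; split; first by apply/eqP => /bP.2 /eqP; rewrite eqn_leq ltnn.
  apply/negP => /mem_belast; rewrite -[_ :: _]/(segment 0 j.+1).
  by move=> /mapP[k]; rewrite mem_iota => /andP[_ kj] /bP.2 ejk; move: kj; rewrite -ejk; lia.
move: lastr; case/shortenP: pathr => s paths us ssub lasts.
have js : b j.+1 \notin b j :: s.
  by apply: contra rj; rewrite !inE => /orP[->//|/ssub ->]; rewrite orbT.
have : ucycle adj (b j.+1 :: b j :: s).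
  apply/andP; split; last by rewrite cons_uniq js.
  rewrite /cycle /= rcons_path paths lasts sym_adj bP.1 /=.
  by rewrite sym_adj bP.1.
move=> /acyc /=; case: s lasts {paths us ssub js} => //= /bP.2 /eqP.
by rewrite eqn_leq; lia.
Qed.

End tree_paths.

(** * Convergence of cyclic classes *)

Section cyclic_convergence.
Context {R : realType} (m : nat).
Implicit Types (u v : simplex R m) (e : nat -> simplex R m).

(** Convergence of cyclic classes expressed on representatives; the aligning
    shift may change with [n]. *)
Definition orbit_cvg e u := forall eps : R, 0 < eps ->
  \forall n \near \oo, exists a : 'Z_m, forall s : 'Z_m,
    `|set_val (e n) 0 s - set_val u 0 (s + a)| < eps.

Lemma cyclic_classP u v : cyclic_class u = cyclic_class v <->
  exists a : 'Z_m, forall s : 'Z_m, set_val u 0 s = set_val v 0 (s + a).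
Proof.
split=> [uv|uv]; first by apply/asboolP/(@eqmodP _ (@cyclic_equiv_rel R m)).
by apply/(@eqmodP _ (@cyclic_equiv_rel R m)); apply/asboolP.
Qed.

Lemma shift_in_simplex u (a : 'Z_m) :
  \row_(s < (Zp_trunc m).+2) set_val u 0 ((s : 'Z_m) + a) \in simplex R m.
Proof.
have [u0 u1] := set_valP u; rewrite inE; split=> [s|]; first by rewrite mxE u0.
under eq_bigr do rewrite mxE.
by rewrite -u1 [RHS](reindex_inj (addIr a)); exact: eq_bigr.
Qed.

Definition shift_simplex u (a : 'Z_m) : simplex R m :=
  exist (fun v : 'rV[R]_(Zp_trunc m).+2 => v \in simplex R m) _ (shift_in_simplex u a).

Lemma shift_simplexE u a s : set_val (shift_simplex u a) 0 s = set_val u 0 (s + a).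
Proof. by rewrite /set_val /= mxE. Qed.

Lemma simplex_coord_continuous s : continuous (fun u => set_val u 0 s : R).
Proof.
move=> u; apply: (@continuous_comp _ _ _ set_val (fun M : 'rV[R]__ => M 0 s)).
  exact: initial_continuous.
exact: coord_continuous.
Qed.

Lemma near_coord u s (r eps : R) : `|set_val u 0 s - r| < eps ->
  nbhs u [set v : simplex R m | `|set_val v 0 s - r| < eps].
Proof.
move=> us; apply: (@simplex_coord_continuous s u [set x | `|x - r| < eps]).
have -> : [set x | `|x - r| < eps] = ball r eps.
  by apply/seteqP; split=> x; rewrite /ball /= distrC.
by apply: open_nbhs_nbhs; split; [exact: ball_open|rewrite /ball /= distrC].
Qed.

Lemma nbhs_simplex u (A : set (simplex R m)) : nbhs u A ->
  \forall eps \near (0 : R)^'+,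
    forall v : simplex R m, (forall s, `|set_val v 0 s - set_val u 0 s| < eps) -> A v.
Proof.
case=> _ /= [] [W oW <- /= Wu WA].
have /nbhs_ballP[r r0 rW] : nbhs (set_val u) W by apply: open_nbhs_nbhs.
near=> eps => v vu; apply: WA => /=; apply: rW; split=> // i j.
rewrite (ord1 i) /ball /= distrC; apply: lt_trans (vu j) _.
by near: eps; exact: nbhs_right_lt.
Unshelve. all: by end_near.
Qed.

(** The classes with a representative within [eps] of [u] form an open set, since
    its preimage is a union over the shifts of open sets.  Conversely the preimage
    of a neighbourhood of the class of [u] contains every shift of [u], and there
    are only finitely many of them, so one radius serves for all. *)
Lemma cvg_cyclic_classP e u :
  cyclic_class (e n) @[n --> \oo] --> cyclic_class u <-> orbit_cvg e u.
Proof.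
split.
  move=> eu eps eps0.
  pose B : set (cyclic_simplex R m) :=
    [set c | exists v : simplex R m, c = cyclic_class v /\
       exists a : 'Z_m, forall s : 'Z_m,
         `|set_val v 0 s - set_val u 0 (s + a)| < eps].
  have BE v : B (cyclic_class v) <-> exists a : 'Z_m, forall s : 'Z_m,
         `|set_val v 0 s - set_val u 0 (s + a)| < eps.
    split=> [[w [/cyclic_classP[c vw] [a wu]]]|]; last by exists v.
    by exists (c + a) => s; rewrite vw addrA.
  have oB : open B.
    rewrite /open /= /quotient_open.
    rewrite openE => v /BE[a va]; rewrite /interior.
    suff : nbhs v [set w : simplex R m | forall s : 'Z_m,
        `|set_val w 0 s - set_val u 0 (s + a)| < eps].
      by apply: filterS => w wa; apply/BE; exists a.
    apply: (@filter_forall _ 'Z_m (fun s : 'Z_m => [set w : simplex R m |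
        `|set_val w 0 s - set_val u 0 (s + a)| < eps]) (nbhs v)) => s.
    by apply: near_coord; exact: va.
  have : nbhs (cyclic_class u) B.
    apply: open_nbhs_nbhs; split=> //; apply/BE; exists 0 => s.
    by rewrite addr0 subrr normr0.
  move=> /eu uB; have {}uB : \forall n \near \oo, B (cyclic_class (e n)) := uB.
  by apply: filterS uB => n /(BE _) [a na]; exists a.
move=> eu B; rewrite nbhsE /= => -[U [oU Uu] UB].
have Usat a : (\pi_(cyclic_simplex R m) @^-1` U)%qT (shift_simplex u a).
  have -> // : (\pi_(cyclic_simplex R m) @^-1` U)%qT (shift_simplex u a) =
     U (cyclic_class u).
  congr U; apply/cyclic_classP; exists a => s; exact: shift_simplexE.
have : \forall eps \near (0 : R)^'+, forall (a : 'Z_m) (v : simplex R m),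
    (forall s : 'Z_m, `|set_val v 0 s - set_val u 0 (s + a)| < eps) -> U (cyclic_class v).
  apply: filter_forall => a.
  have : nbhs (shift_simplex u a)
      ((\pi_(cyclic_simplex R m) @^-1` U)%qT : set (simplex R m)).
    by apply: open_nbhs_nbhs; split; [exact: oU|exact: Usat].
  move=> /nbhs_simplex; apply: filterS => eps near_eps v va; apply: near_eps => s.
  by rewrite shift_simplexE.
move=> /(filterI (nbhs_right_gt 0)) /filter_ex[eps [eps0 epsU]].
by apply: filterS (eu _ eps0) => n [a na]; apply: UB; exact: epsU na.
Qed.

(** Two limits with no common shift are a positive distance apart after every
    shift, which contradicts a common approximation. *)
Lemma orbit_cvg_unique e u v : orbit_cvg e u -> orbit_cvg e v ->
  exists a : 'Z_m, forall s : 'Z_m, set_val u 0 s = set_val v 0 (s + a).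
Proof.
move=> eu ev; apply: contrapT => neq.
have {}neq (a : 'Z_m) : exists s : 'Z_m, set_val u 0 s != set_val v 0 (s + a).
  apply: contrapT => eqa; apply: neq; exists a => s; apply/eqP.
  by apply: contrapT => /negP suv; apply: eqa; exists s.
have : \forall eps \near (0 : R)^'+, forall (a : 'Z_m), exists s : 'Z_m,
    eps + eps < `|set_val u 0 s - set_val v 0 (s + a)|.
  apply: filter_forall => a; have [s] := neq a; rewrite -subr_eq0 -normr_gt0 => gt0.
  near=> eps; exists s.
  rewrite -mulr2n -mulr_natr -ltr_pdivlMr//; near: eps; apply: nbhs_right_lt.
  by rewrite divr_gt0.
move=> /(filterI (nbhs_right_gt 0)) /filter_ex[eps [eps0 far]].
have [n [[a na] [c nc]]] := filter_ex (filterI (eu _ eps0) (ev _ eps0)).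
have [s] := far (c - a).
suff : `|set_val u 0 s - set_val v 0 (s + (c - a))| < eps + eps
  by move=> /ltW; rewrite leNgt => /negP.
move: (na (s - a)) (nc (s - a)); rewrite subrK addrAC -addrA distrC => ua vc.
rewrite (le_lt_trans (ler_distD (set_val (e n) 0 (s - a)) _ _))// ltrD//.
Unshelve. all: end_near.
Qed.

End cyclic_convergence.

(** * Residues and sums over residue classes *)

Section residues.

Lemma residue_shift (m : nat) (i k : int) : (1 < m)%N ->
  (i + m%:Z * k)%:~R = i%:~R :> 'Z_m.
Proof.
move=> m1; rewrite intrD intrM -pmulrn; have -> : (m%:R : 'Z_m) = 0 by exact: pchar_Zp.
by rewrite mul0r addr0.
Qed.

Lemma val_residue (m : nat) (i : int) : (1 < m)%N ->
  exists k : int, i = (val (i%:~R : 'Z_m))%:Z + m%:Z * k.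
Proof.
move=> m1; exists (i %/ m%:Z)%Z.
have [n en] : exists n : nat, (i %% m%:Z)%Z = n%:Z.
  by exists `|(i %% m%:Z)%Z|%N; rewrite gez0_abs // modz_ge0 //; lia.
have nm : (n < m)%N.
  by rewrite -ltz_nat -en ltz_pmod//; lia.
have ei : i = n%:Z + m%:Z * (i %/ m%:Z)%Z by rewrite -en {1}(divz_eq i m%:Z) addrC mulrC.
have -> : val (i%:~R : 'Z_m) = n.
  by rewrite {1}ei residue_shift // -pmulrn [LHS](val_Zp_nat m1) modn_small.
exact: ei.
Qed.

Lemma natr_residue (m : nat) (s : 'Z_m) : ((val s)%:Z)%:~R = s.
Proof. by rewrite -pmulrn natr_Zp. Qed.

Lemma periodic_mul (R : realType) (lam : int -> R) (q : nat) (i k : int) :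
  periodic lam q -> lam (i + q%:Z * k) = lam i.
Proof.
move=> per; have pos (n : nat) j : lam (j + q%:Z * n%:Z) = lam j.
  elim: n => [|n IH]; first by rewrite mulr0 addr0.
  by rewrite -[n.+1]addn1 PoszD mulrDr mulr1 addrA per.
case: k => n; first exact: pos.
by rewrite -(pos n.+1 (i + _)) NegzE mulrN subrK.
Qed.

Lemma periodic_unfold (R : realType) (m : nat) (l : 'Z_m -> R) : (1 < m)%N ->
  periodic (unfold_Z l) m.
Proof.
by move=> m1 i; rewrite /unfold_Z -[in LHS](mulr1 m%:Z) residue_shift.
Qed.

(** A periodic function can be read modulo any multiple of its period; this is
    how laws of different periods are brought to one state space. *)
Definition fold_Z {R : realType} (m : nat) (lam : int -> R) : 'Z_m -> R :=
  fun s => lam (val s)%:Z.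

Lemma fold_ZK (R : realType) (m : nat) (lam : int -> R) : (1 < m)%N ->
  periodic lam m -> unfold_Z (@fold_Z R m lam) = lam.
Proof.
move=> m1 per; apply/funext => i; rewrite /unfold_Z /fold_Z.
by have [k {2}->] := val_residue i m1; rewrite (periodic_mul _ _ per).
Qed.

Lemma unfold_ZK (R : realType) (m : nat) (l : 'Z_m -> R) :
  @fold_Z R m (unfold_Z l) = l.
Proof. by apply/funext => s; rewrite /unfold_Z /fold_Z natr_residue. Qed.

Lemma periodic_dvd (R : realType) (lam : int -> R) (q m : nat) :
  (q %| m)%N -> periodic lam q -> periodic lam m.
Proof.
by move=> /dvdnP[k ->] per i; rewrite PoszM mulrC periodic_mul.
Qed.

End residues.

Arguments fold_Z {R} m lam s.

Section esum_extra.
Local Open Scope ereal_scope.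
Context {R : realType}.

Lemma esumZl (T : choiceType) (I : set T) (c : R) (a : T -> \bar R) :
  (0 <= c)%R -> (forall i, 0 <= a i) ->
  \esum_(i in I) (c%:E * a i) = c%:E * \esum_(i in I) a i.
Proof.
rewrite le_eqVlt => /predU1P[<- _|].
  by rewrite mul0e esum1 // => i _; rewrite mul0e.
have le (e : R) (f : T -> \bar R) : (0 < e)%R -> (forall i, 0 <= f i) ->
    \esum_(i in I) (e%:E * f i) <= e%:E * \esum_(i in I) f i.
  move=> e0 f0; apply: ge_ereal_sup => _ [X [finX XI] <-].
  rewrite -ge0_mule_fsumr; last by [].
  by apply: lee_wpmul2l; [rewrite lee_fin ltW|apply: esum_ge; exists X].
move=> c0 a0; apply/eqP; rewrite eq_le le//=.
have ca0 i : 0 <= c%:E * a i by rewrite mule_ge0// lee_fin ltW.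
have := le c^-1%R _ (etrans (invr_gt0 c) c0) ca0.
under eq_esum do rewrite muleA -EFinM mulVf ?gt_eqF// mul1e.
by rewrite -(@lee_pmul2l _ c%:E) // ?lte_fin // muleA -EFinM mulfV ?gt_eqF// mul1e.
Qed.

Lemma ge_esum (T : choiceType) (I : set T) (a : T -> \bar R) t :
  (forall i, 0 <= a i) -> I t -> a t <= \esum_(i in I) a i.
Proof.
move=> a0 It; apply: esum_ge; exists [set t]; first by split => // _ ->.
by rewrite fsbig_set1.
Qed.

Lemma subset_esum (T : choiceType) (I J : set T) (a : T -> \bar R) :
  (forall i, 0 <= a i) -> I `<=` J -> \esum_(i in I) a i <= \esum_(i in J) a i.
Proof.
move=> a0 IJ; rewrite [leLHS]esum_mkcond [leRHS]esum_mkcond; apply: le_esum => i _.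
case: ifPn => [/[!inE] /IJ iJ|_]; first by rewrite ifT// inE.
by case: ifP.
Qed.

End esum_extra.

Section fuzzy.
Context {R : realType} (Q : int -> R).
Hypothesis Q_transfer : transfer_operator Q.

Let Q_gt0 : forall x, 0 < Q x. Proof. by have [] := Q_transfer. Qed.
Let Q_even : forall x, Q (- x) = Q x. Proof. by have [] := Q_transfer. Qed.

Lemma esum_Q_fin (I : set int) : \esum_(x in I) (Q x)%:E \is a fin_num.
Proof.
rewrite ge0_fin_numE; last by apply: esum_ge0 => x _; rewrite lee_fin ltW.
have [_ _] := Q_transfer; rewrite /summable => sQ; apply: le_lt_trans sQ.
under [leRHS]eq_esum do rewrite /= ger0_norm ?ltW//.
by apply: subset_esum => // x; rewrite lee_fin ltW.
Qed.

Section modulus.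
Variable m : nat.

Lemma fuzzy_QE (s : 'Z_m) :
  (fuzzy_Q Q s)%:E = \esum_(k in [set k : int | k%:~R = s :> 'Z_m]) (Q k)%:E.
Proof. by rewrite fineK // esum_Q_fin. Qed.

Lemma fuzzy_Q_gt0 (s : 'Z_m) : 0 < fuzzy_Q Q s.
Proof.
rewrite -lte_fin fuzzy_QE; apply: (@lt_le_trans _ _ (Q (val s)%:Z)%:E).
  by rewrite lte_fin.
apply: (@ge_esum _ _ _ (fun x => (Q x)%:E)); first by move=> x; rewrite lee_fin ltW.
exact: natr_residue.
Qed.

Lemma fuzzy_Q_even (s : 'Z_m) : fuzzy_Q Q (- s) = fuzzy_Q Q s.
Proof.
apply/EFin_inj; rewrite !fuzzy_QE.
rewrite (@reindex_esum _ _ _ [set k : int | k%:~R = s :> 'Z_m] _ (fun x => - x)).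
  by under eq_esum do rewrite Q_even.
split=> [x /= <-|x y _ _ /oppr_inj//|x /= xs]; first by rewrite intrN.
by exists (- x); rewrite ?opprK//= intrN xs opprK.
Qed.

(** Sorting the integers by their residue turns sums over increments into finite
    sums weighted by the fuzzy operator. *)
Lemma esum_residue (g : 'Z_m -> R) : (forall s, 0 <= g s) ->
  \esum_(x in [set: int]) (Q x * g x%:~R)%:E = (\sum_(s : 'Z_m) fuzzy_Q Q s * g s)%:E.
Proof.
move=> g0; rewrite -sumEFin.
transitivity (\esum_(x in [set: int]) \sum_(s : 'Z_m)
   if x \in [set k : int | k%:~R = s :> 'Z_m] then ((g s)%:E * (Q x)%:E)%E else 0%E).
  apply: eq_esum => x _; rewrite (bigD1 (x%:~R : 'Z_m))//= mem_set//.
  rewrite big1 ?adde0 -?EFinM 1?mulrC// => s sx; rewrite ifF//.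
  by apply/negP; rewrite inE => xs; rewrite xs eqxx in sx.
rewrite esum_sum; last first.
  by move=> x s _ _; case: ifP => // _; rewrite -EFinM lee_fin mulr_ge0// ltW.
apply: eq_bigr => s _; rewrite -esum_mkcond esumZl//.
  by rewrite -fuzzy_QE -EFinM mulrC.
by move=> x; rewrite lee_fin ltW.
Qed.

End modulus.
End fuzzy.

(** * The height chain and its stationary distribution *)

Section kernel.
Context {R : realType} (Q : int -> R).
Hypothesis Q_transfer : transfer_operator Q.

Let Q_gt0 : forall x, 0 < Q x. Proof. by have [] := Q_transfer. Qed.

(** Summing over all integers, rather than over residues, makes this quantity
    independent of the modulus at which the law is read. *)
Definition normalization (lam : int -> R) (i : int) : R :=
  fine (\esum_(j in [set: int]) (Q (i - j) * lam j)%:E).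

(** The probability that the height chain started from [i] moves by [x]. *)
Definition step_weight (lam : int -> R) (i x : int) : R :=
  Q x * lam (i + x) / normalization lam i.

Section modulus.
Variables (m : nat) (l : 'Z_m -> R).
Hypothesis l_gt0 : forall s, 0 < l s.

Lemma esum_normalization i :
  \esum_(j in [set: int]) (Q (i - j) * unfold_Z l j)%:E =
  (\sum_(s : 'Z_m) fuzzy_Q Q (i%:~R - s) * l s)%:E.
Proof.
rewrite (@reindex_esum _ _ _ [set: int] _ (fun x => i - x)); last first.
  split=> // [x y _ _ /addrI/oppr_inj//|x _]; by exists (i - x); rewrite ?subKr.
have -> : \sum_(s : 'Z_m) fuzzy_Q Q (i%:~R - s) * l s =
          \sum_(s : 'Z_m) fuzzy_Q Q s * l (i%:~R - s).
  rewrite (reindex_inj (subrI (i%:~R : 'Z_m))).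
  by apply: eq_bigr => s _; rewrite subKr.
rewrite -(esum_residue Q_transfer (g := fun s => l (i%:~R - s))); last first.
  by move=> s; exact: ltW.
by apply: eq_esum => x _; rewrite subKr /unfold_Z intrB.
Qed.

Lemma normalizationE i :
  normalization (unfold_Z l) i = \sum_(s : 'Z_m) fuzzy_Q Q (i%:~R - s) * l s.
Proof. by rewrite /normalization esum_normalization. Qed.

Lemma normalization_gt0 i : 0 < normalization (unfold_Z l) i.
Proof.
rewrite normalizationE (bigD1 0)//= ltr_pwDl ?mulr_gt0 ?fuzzy_Q_gt0//.
by apply: sumr_ge0 => s _; rewrite mulr_ge0 ?ltW ?fuzzy_Q_gt0.
Qed.

Lemma step_weight_gt0 i x : 0 < step_weight (unfold_Z l) i x.
Proof. by rewrite divr_gt0 ?normalization_gt0 ?mulr_gt0//; exact: l_gt0. Qed.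

Lemma fuzzy_transitionE i s : fuzzy_transition Q l i%:~R s =
  fuzzy_Q Q (i%:~R - s) * l s / normalization (unfold_Z l) i.
Proof. by rewrite normalizationE. Qed.

Lemma fuzzy_transition_gt0 r s : 0 < fuzzy_transition Q l r s.
Proof.
rewrite -(natr_residue r) fuzzy_transitionE.
by rewrite divr_gt0 ?mulr_gt0 ?fuzzy_Q_gt0 ?normalization_gt0.
Qed.

Lemma fuzzy_transition_sum1 r : \sum_s fuzzy_transition Q l r s = 1.
Proof.
rewrite -(natr_residue r); under eq_bigr do rewrite fuzzy_transitionE.
by rewrite -mulr_suml -normalizationE divff// gt_eqF// normalization_gt0.
Qed.

(** Modulo [m] the height chain is the fuzzy chain. *)
Lemma esum_step_weight i (v : 'Z_m -> R) : (forall s, 0 <= v s) ->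
  \esum_(x in [set: int]) (step_weight (unfold_Z l) i x * v (i + x)%:~R)%:E =
  (\sum_(s : 'Z_m) fuzzy_transition Q l i%:~R s * v s)%:E.
Proof.
move=> v0; pose N := normalization (unfold_Z l) i.
pose g (s : 'Z_m) := l (i%:~R + s) / N * v (i%:~R + s).
transitivity (\esum_(x in [set: int]) (Q x * g x%:~R)%:E).
  by apply: eq_esum => x _; rewrite /g /step_weight /unfold_Z -intrD !mulrA.
rewrite esum_residue//; last first.
  by move=> s; rewrite mulr_ge0// divr_ge0 ?ltW ?normalization_gt0.
congr EFin; rewrite (reindex_inj (addIr (- (i%:~R : 'Z_m)))).
apply: eq_bigr => s _ /=; rewrite fuzzy_transitionE /g.
by rewrite -(fuzzy_Q_even Q_transfer) opprB addrC addrA addrAC subrr add0r !mulrA.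
Qed.

Section stationary.
Variable d : nat.
Hypothesis d_gt0 : (0 < d)%N.

Lemma fuzzy_stationary_gt0 s : 0 < fuzzy_stationary d l s.
Proof.
rewrite divr_gt0 ?powR_gt0// (bigD1 s)//= ltr_pwDl ?powR_gt0//.
by apply: sumr_ge0 => r _; rewrite powR_ge0.
Qed.

Lemma fuzzy_stationary_sum1 : \sum_s fuzzy_stationary d l s = 1.
Proof.
rewrite -mulr_suml divff// gt_eqF// (bigD1 0)//= ltr_pwDl ?powR_gt0//.
by apply: sumr_ge0 => r _; rewrite powR_ge0.
Qed.

(** The boundary law equation says that [l] is, up to a constant, the [d]-th
    power of the normalisation, so that [l ^ ((d + 1) / d)] is [l] times the
    normalisation up to a constant: this cancels the denominator of the
    transition probability and leaves a symmetric expression. *)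
Lemma fuzzy_reversible : periodic_boundary_law d Q m (unfold_Z l) ->
  forall r s, fuzzy_stationary d l r * fuzzy_transition Q l r s =
              fuzzy_stationary d l s * fuzzy_transition Q l s r.
Proof.
case=> _ _ [c c0 claw].
have power (i : int) : l i%:~R `^ (d.+1%:R / d%:R) =
    c `^ d%:R^-1 * (l i%:~R * normalization (unfold_Z l) i).
  have d0 : d%:R != 0 :> R by rewrite pnatr_eq0 -lt0n.
  have N0 := normalization_gt0 i.
  have /(congr1 (fun x => x `^ d%:R^-1)) : l i%:~R = c * normalization (unfold_Z l) i ^+ d.
    have := claw i; rewrite esum_normalization -EFin_expe -EFinM => -[].
    by rewrite -normalizationE.
  rewrite powRM ?ltW ?exprn_gt0// -powR_mulrn ?ltW// -powRrM mulfV// powRr1 ?ltW//.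
  move=> eN; have -> : d.+1%:R / d%:R = 1 + d%:R^-1 :> R.
    by rewrite -natr1 mulrDl mulfV// mul1r.
  by rewrite powRD ?(gt_eqF (l_gt0 _)) ?implybT// powRr1 ?ltW// eN mulrCA.
move=> r s; rewrite -(natr_residue r) -(natr_residue s) /fuzzy_stationary !power.
rewrite !fuzzy_transitionE -[in RHS](fuzzy_Q_even Q_transfer) opprB.
have := normalization_gt0 (val r)%:Z; have := normalization_gt0 (val s)%:Z.
have : 0 < \sum_j l j `^ (d.+1%:R / d%:R).
  rewrite (bigD1 0)//= ltr_pwDl ?powR_gt0//.
  by apply: sumr_ge0 => j _; rewrite powR_ge0.
move=> /lt0r_neq0 S0 /lt0r_neq0 Ns /lt0r_neq0 Nr.
by field; rewrite S0 Ns Nr.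
Qed.

Lemma fuzzy_stationaryP : periodic_boundary_law d Q m (unfold_Z l) ->
  forall s, \sum_r fuzzy_stationary d l r * fuzzy_transition Q l r s =
            fuzzy_stationary d l s.
Proof.
move=> law s; under eq_bigr do rewrite (fuzzy_reversible law).
by rewrite -mulr_sumr fuzzy_transition_sum1 mulr1.
Qed.

End stationary.
End modulus.
End kernel.

(** * Poisson equation and exponential moments *)

Section poisson.
Context {R : realType} (n : nat) (P : 'I_n -> 'I_n -> R) (p : 'I_n -> R).
Hypothesis P_gt0 : forall i j, 0 < P i j.
Hypothesis P_sum1 : forall i, \sum_j P i j = 1.
Hypothesis p_sum1 : \sum_i p i = 1.
Hypothesis p_stationary : forall j, \sum_i p i * P i j = p j.

(** At a maximum the average is attained only if no value falls below it, as all
    the weights are positive. *)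
Lemma harmonic_constant (v : 'I_n -> R) :
  (forall i, v i = \sum_j P i j * v j) -> forall i j, v i = v j.
Proof.
move=> harm i0; have [i _ imax] := Order.TotalTheory.arg_maxP v (erefl : xpredT i0).
suff eqi j : v j = v i by move=> j; rewrite !eqi.
have /eqP : \sum_j P i j * (v i - v j) = 0.
  under eq_bigr do rewrite mulrBr.
  by rewrite sumrB -mulr_suml P_sum1 mul1r -harm subrr.
rewrite psumr_eq0; last first.
  by move=> k _; rewrite mulr_ge0 ?(ltW (P_gt0 _ _))// subr_ge0; exact: imax.
move=> /allP /(_ j); rewrite mem_index_enum => /(_ isT) /=.
by rewrite mulf_eq0 gt_eqF//= subr_eq0 => /eqP.
Qed.

(** The operator to invert is [I - P + 1 p]: a function that it kills has mean 0
    by stationarity, hence is harmonic, hence constant, hence 0. *)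
Lemma poisson_equation (f : 'I_n -> R) : \sum_i p i * f i = 0 ->
  exists g : 'I_n -> R, forall i, f i = g i - \sum_j P i j * g j.
Proof.
move=> pf0.
pose A : 'M[R]_n := \matrix_(i, j) ((j == i)%:R - P j i + p i).
have AE (v : 'rV[R]_n) j : (v *m A) 0 j =
    v 0 j - \sum_i P j i * v 0 i + \sum_i p i * v 0 i.
  rewrite mxE; under eq_bigr => i _ do rewrite mxE mulrDr mulrBr.
  rewrite big_split sumrB /=; congr (_ - _ + _); last 2 first.
  - by apply: eq_bigr => i _; rewrite mulrC.
  - by apply: eq_bigr => i _; rewrite mulrC.
  rewrite (bigD1 j)//= eqxx mulr1 big1 ?addr0// => i /negPf.
  by rewrite eq_sym => ->; rewrite mulr0.
have meanA (v : 'rV[R]_n) : \sum_j p j * (v *m A) 0 j = \sum_j p j * v 0 j.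
  under eq_bigr => j _ do rewrite AE mulrDr mulrBr.
  rewrite big_split sumrB /= -mulr_suml p_sum1 mul1r.
  suff -> : \sum_i p i * (\sum_i0 P i i0 * v 0 i0) = \sum_i p i * v 0 i.
    by rewrite subrr add0r.
  under eq_bigr do rewrite mulr_sumr.
  rewrite exchange_big; apply: eq_bigr => i _ /=.
  by under eq_bigr do rewrite mulrA; rewrite -mulr_suml p_stationary.
have Aunit : A \in unitmx.
  rewrite -row_free_unit; apply: inj_row_free => v vA0.
  have mean0 : \sum_j p j * v 0 j = 0.
    by rewrite -meanA vA0; under eq_bigr do rewrite mxE mulr0; rewrite big1.
  have harm i : v 0 i = \sum_j P i j * v 0 j.
    have := AE v i; rewrite vA0 mxE mean0 addr0 => /esym/eqP.
    by rewrite subr_eq0 => /eqP.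
  apply/rowP => i; rewrite mxE -[RHS]mean0.
  have const := harmonic_constant harm.
  by under eq_bigr do rewrite (const _ i); rewrite -mulr_suml p_sum1 mul1r.
pose g := \row_i f i *m invmx A.
have gA : g *m A = \row_i f i by rewrite mulmxKV.
have mean0 : \sum_j p j * g 0 j = 0.
  rewrite -meanA gA -[RHS]pf0; by under eq_bigr do rewrite mxE.
exists (fun i => g 0 i) => i.
by have := AE g i; rewrite gA mxE mean0 addr0.
Qed.

End poisson.

Section exponential.
Context {R : realType}.

Lemma expR_quadratic (y : R) : `|y| <= 1 / 2 -> expR y <= 1 + y + 2 * y ^+ 2.
Proof.
rewrite ler_norml => /andP[y1 y2].
have e1 : 1 - y <= expR (- y) by exact: expR_ge1Dx.
have e0 := expR_gt0 y; have : expR y * expR (- y) = 1 by rewrite expRN mulfV// gt_eqF.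
move: e1 e0; move: (expR y) (expR (- y)) => a b ab a0 ab1.
(* [1 / (1 - y) <= 1 + y + 2 y^2] in this range. *)
have : a * (1 - y) <= 1 by rewrite -[leRHS]ab1 ler_pM2l.
nra.
Qed.

(** Centred increments have no linear term in the exponential moment. *)
Lemma expR_moment (n : nat) (P g : 'I_n -> R) (t K : R) :
  (forall j, 0 <= P j) -> \sum_j P j = 1 -> (forall j, `|g j| <= K) ->
  0 <= t -> 2 * (t * K) <= 1 / 2 ->
  \sum_j P j * expR (t * g j) <=
  (1 + 8 * (t * K) ^+ 2) * expR (t * \sum_j P j * g j).
Proof.
move=> P0 P1 gK t0 tK; set mean := \sum_j P j * g j.
have meanK : `|mean| <= K.
  rewrite (le_trans (ler_norm_sum _ _ _))// -[K]mul1r -P1 mulr_suml.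
  by apply: ler_sum => j _; rewrite normrM (ger0_norm (P0 j)) ler_wpM2l.
have term j : P j * expR (t * g j) <=
    P j * (1 + t * (g j - mean) + 8 * (t * K) ^+ 2) * expR (t * mean).
  have -> : t * g j = t * (g j - mean) + t * mean by ring.
  rewrite expRD mulrA ler_wpM2r ?expR_ge0// ler_wpM2l//.
  have dev : `|t * (g j - mean)| <= 2 * (t * K).
    rewrite normrM (ger0_norm t0) mulrCA ler_wpM2l// mulr_natl mulr2n.
    by rewrite (le_trans (ler_normB _ _))// lerD.
  rewrite (le_trans (expR_quadratic (le_trans dev tK)))// lerD2l.
  have : (t * (g j - mean)) ^+ 2 <= (2 * (t * K)) ^+ 2.
    by rewrite -real_normK ?num_real// lerXn2r ?nnegrE// (le_trans _ dev).
  by rewrite exprMn; lra.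
rewrite (le_trans (ler_sum _ (fun j _ => term j)))// -mulr_suml ler_wpM2r ?expR_ge0//.
under eq_bigr do rewrite mulrDr mulrDr mulr1.
rewrite !big_split /= P1 -mulr_suml P1 mul1r.
under eq_bigr do rewrite mulrCA mulrBr.
by rewrite -mulr_sumr sumrB -mulr_suml P1 mul1r subrr mulr0 addr0.
Qed.

End exponential.

(** * Concentration of occupation frequencies *)

Section finite_unions.
Context {R : realType}.
Local Open Scope ereal_scope.

Lemma esum_union_le (T : choiceType) (I : finType) (A : I -> set T)
    (a : T -> \bar R) : (forall x, 0 <= a x) ->
  \esum_(x in [set x | exists i, A i x]) a x <= \sum_i \esum_(x in A i) a x.
Proof.
move=> a0; rewrite esum_mkcond.
under [leRHS]eq_bigr do rewrite esum_mkcond.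
have aA0 i x : 0 <= (if x \in A i then a x else 0) by case: ifP.
rewrite -esum_sum//; apply: le_esum => x _; case: ifPn => [|_]; last first.
  by apply: sume_ge0 => i _.
rewrite inE => -[i Aix]; rewrite (bigD1 i)//= mem_set// leeDl//.
by apply: sume_ge0 => j _.
Qed.

End finite_unions.

Section words.
Context {R : realType} (Q : int -> R).

(** The probability of the increments [xs] for the height chain started from [i]. *)
Fixpoint path_weight (lam : int -> R) (i : int) (xs : seq int) : R :=
  if xs is x :: xs' then step_weight Q lam i x * path_weight lam (i + x) xs' else 1.

(** Both ends of the trajectory count, so there are [(size xs).+1] terms. *)
Fixpoint path_sum (m : nat) (f : 'Z_m -> R) (i : int) (xs : seq int) : R :=
  f i%:~R + if xs is x :: xs' then path_sum f (i + x) xs' else 0.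

Lemma esum_words (n : nat) (a : seq int -> \bar R) : (forall xs, 0 <= a xs)%E ->
  (\esum_(xs in [set xs | size xs = n.+1]) a xs =
   \esum_(x in [set: int]) \esum_(xs in [set xs | size xs = n]) a (x :: xs))%E.
Proof.
move=> a0; rewrite esum_esum//.
rewrite (@reindex_esum _ _ _
  ([set: int] `*`` (fun _ => [set xs : seq int | size xs = n])) _ (fun p => p.1 :: p.2))//.
split=> [[x xs] /= [_ ->]//|[x xs] [y ys] _ _ /= [-> ->]//|[//|x xs] /= [sxs]].
by exists (x, xs).
Qed.

End words.

Section deviations.
Context {R : realType} (Q : int -> R).
Hypothesis Q_transfer : transfer_operator Q.
Variables (m : nat) (l : 'Z_m -> R).
Hypothesis l_gt0 : forall s, 0 < l s.

Lemma path_weight_gt0 i xs : 0 < path_weight Q (unfold_Z l) i xs.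
Proof.
elim: xs i => //= x xs IH i; rewrite mulr_gt0//.
exact: step_weight_gt0.
Qed.

(** Each step of the chain multiplies the exponential moment corrected by
    [expR (t * g)] by the exponential moment of a centred increment of [g]. *)
Lemma path_sum_moment (f g : 'Z_m -> R) (t K : R) :
  (forall s, f s = g s - \sum_r fuzzy_transition Q l s r * g r) ->
  (forall s, `|g s| <= K) -> 0 <= t -> 2 * (t * K) <= 1 / 2 ->
  forall n i,
  (\esum_(xs in [set xs | size xs = n])
     (path_weight Q (unfold_Z l) i xs * expR (t * path_sum f i xs))%:E <=
   ((1 + 8 * (t * K) ^+ 2) ^+ n * expR (t * K) * expR (t * g i%:~R))%:E)%E.
Proof.
move=> fg gK t0 tK; set rho := 1 + _.
have K0 : 0 <= K by rewrite (le_trans _ (gK 0)).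
have rho1 : 1 <= rho by rewrite lerDl mulr_ge0// sqr_ge0.
have rho0 : 0 <= rho by rewrite (le_trans _ rho1).
have trans0 s r : 0 <= fuzzy_transition Q l s r by rewrite ltW// fuzzy_transition_gt0.
have trans1 s := fuzzy_transition_sum1 Q_transfer l_gt0 s.
have w0 i xs : 0 <= path_weight Q (unfold_Z l) i xs by rewrite ltW// path_weight_gt0.
elim=> [|n IH] i.
  have -> : [set xs : seq int | size xs = 0] = [set [::]].
    by apply/seteqP; split=> [[]|_ ->].
  rewrite esum_set1 /= ?lee_fin ?mulr_ge0 ?expR_ge0//.
  rewrite !mul1r addr0 -expRD ler_expR -mulrDr ler_wpM2l// fg addrC lerD2r.
  rewrite (le_trans (ler_norm _))// normrN (le_trans (ler_norm_sum _ _ _))//.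
  rewrite -[K]mul1r -(trans1 i%:~R) mulr_suml ler_sum// => s _.
  by rewrite normrM (ger0_norm (trans0 _ _)) ler_wpM2l.
rewrite esum_words; last by move=> xs; rewrite lee_fin mulr_ge0 ?expR_ge0.
pose c := expR (t * f i%:~R) * (rho ^+ n * expR (t * K)).
have c0 : 0 <= c by rewrite !mulr_ge0 ?expR_ge0// exprn_ge0.
apply: (@le_trans _ _ (\esum_(x in [set: int])
    (c%:E * (step_weight Q (unfold_Z l) i x * expR (t * g (i + x)%:~R))%:E))%E).
  apply: le_esum => x _ /=.
  have st0 : 0 <= step_weight Q (unfold_Z l) i x by rewrite ltW// step_weight_gt0.
  under eq_esum do rewrite mulrDr expRD mulrACA EFinM.
  rewrite esumZl; last 2 first.
  - by rewrite mulr_ge0// expR_ge0.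
  - by move=> xs; rewrite lee_fin mulr_ge0// expR_ge0.
  have se0 : (0 <= (step_weight Q (unfold_Z l) i x * expR (t * f i%:~R))%:E)%E.
    by rewrite lee_fin mulr_ge0// expR_ge0.
  apply: le_trans (lee_wpmul2l se0 (IH (i + x))) _.
  by rewrite -!EFinM lee_fin /c le_eqVlt; apply/orP; left; apply/eqP; ring.
have stg0 x : (0 <= (step_weight Q (unfold_Z l) i x * expR (t * g (i + x)%:~R))%:E)%E.
  by rewrite lee_fin mulr_ge0 ?expR_ge0// ltW// step_weight_gt0.
rewrite esumZl// (esum_step_weight Q_transfer l_gt0 i (v := fun s => expR (t * g s))); last first.
  by move=> s; exact: expR_ge0.
have step := expR_moment (trans0 i%:~R) (trans1 i%:~R) gK t0 tK.
rewrite -EFinM lee_fin (le_trans (ler_wpM2l c0 step))// -/rho /c.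
have -> : t * g i%:~R = t * f i%:~R + t * \sum_r fuzzy_transition Q l i%:~R r * g r.
  by rewrite fg; ring.
by rewrite expRD exprS le_eqVlt; apply/orP; left; apply/eqP; ring.
Qed.

Variable d : nat.
Hypothesis d_gt0 : (0 < d)%N.
Hypothesis law : periodic_boundary_law d Q m (unfold_Z l).

(** Exponential Markov inequality.  Writing [f] as [g - P g] turns the sum of [f]
    into a sum of centred increments of [g], whose exponential moment grows like
    [1 + 8 (t K)^2] per step, against a gain of [exp (t eps)] from the deviation;
    for small [t] the linear gain wins. *)
Lemma path_sum_large (f : 'Z_m -> R) (eps : R) :
  \sum_s fuzzy_stationary d l s * f s = 0 -> 0 < eps ->
  exists C r : R, [/\ 0 <= C, 0 <= r, r < 1 & forall n i,
  (\esum_(xs in [set xs | size xs = n /\ (eps * n.+1%:R < path_sum f i xs)%R])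
     (path_weight Q (unfold_Z l) i xs)%:E <= (C * r ^+ n)%:E)%E].
Proof.
move=> f0 eps0.
have [g fg] := poisson_equation (fuzzy_transition_gt0 Q_transfer l_gt0)
  (fuzzy_transition_sum1 Q_transfer l_gt0) (fuzzy_stationary_sum1 l_gt0 d)
  (fuzzy_stationaryP Q_transfer l_gt0 d_gt0 law) f0.
pose K : R := 1 + \sum_s `|g s|.
have gK s : `|g s| <= K.
  rewrite /K (bigD1 s)//= addrCA lerDl addr_ge0// sumr_ge0//.
have K1 : 1 <= K by rewrite lerDl sumr_ge0.
have K0 : 0 < K by rewrite (lt_le_trans ltr01).
(* The step size [t] is small enough for the quadratic term to be negligible. *)
have [t [t0 tK tK2]] : exists t, [/\ 0 < t, 2 * (t * K) <= 1 / 2 &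
    8 * (t * K) ^+ 2 < t * eps].
  pose D := 16 * K ^+ 2 * (1 + eps).
  have D0 : 0 < D by rewrite /D mulr_gt0 ?addr_gt0 ?mulr_gt0 ?exprn_gt0.
  have Ke : 0 < K * eps by exact: mulr_gt0.
  exists (eps / D); split; first exact: divr_gt0.
    have -> : 2 * (eps / D * K) = 2 * eps * K / D by ring.
    rewrite ler_pdivrMr// /D; nra.
  have -> : 8 * (eps / D * K) ^+ 2 = eps / D * (8 * eps * K ^+ 2 / D) by ring.
  rewrite ltr_pM2l ?divr_gt0// ltr_pdivrMr// /D.
  have K20 : 0 < K ^+ 2 by exact: exprn_gt0.
  have : 0 < eps * K ^+ 2 by exact: mulr_gt0.
  by nra.
set rho := 1 + 8 * (t * K) ^+ 2.
exists (expR (2 * (t * K))), (rho * expR (- (t * eps))).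
have rho0 : 0 < rho by rewrite ltr_pwDl// mulr_ge0// sqr_ge0.
split; rewrite ?mulr_ge0 ?expR_ge0 ?(ltW rho0)//.
  rewrite expRN ltr_pdivrMr ?expR_gt0// mul1r (lt_le_trans _ (expR_ge1Dx _))//.
  by rewrite ltrD2l.
move=> n i.
have w0 xs : 0 <= path_weight Q (unfold_Z l) i xs by rewrite ltW// path_weight_gt0.
have e0 : 0 <= expR (- (t * eps) * n.+1%:R) by exact: expR_ge0.
apply: (@le_trans _ _ (\esum_(xs in [set xs | size xs = n])
   ((expR (- (t * eps) * n.+1%:R))%:E *
    (path_weight Q (unfold_Z l) i xs * expR (t * path_sum f i xs))%:E))%E).
  rewrite [leLHS]esum_mkcond [leRHS]esum_mkcond; apply: le_esum => xs _.
  case: ifPn => [/[!inE] -[sxs large]|_]; last first.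
    by case: ifP => // _; rewrite -EFinM lee_fin !mulr_ge0 ?expR_ge0.
  rewrite ifT ?inE// -EFinM lee_fin mulrCA ler_peMr// -expRD -[leLHS]expR0 ler_expR.
  by rewrite mulNr addrC subr_ge0 -mulrA ler_pM2l// ltW.
rewrite esumZl//; last by move=> xs; rewrite lee_fin mulr_ge0 ?expR_ge0.
have := path_sum_moment fg gK (ltW t0) tK n i =>
  /(lee_wpmul2l (x := (expR (- (t * eps) * n.+1%:R))%:E)).
rewrite lee_fin => /(_ e0)/le_trans; apply.
rewrite -EFinM lee_fin -/rho.
have gt : expR (t * g i%:~R) <= expR (t * K).
  by rewrite ler_expR ler_wpM2l ?(ltW t0)// (le_trans (ler_norm _)).
have decay : expR (- (t * eps) * n.+1%:R) <= expR (- (t * eps)) ^+ n.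
  rewrite -expRM_natl ler_expR [leRHS]mulrC !mulNr lerN2.
  by rewrite ler_wpM2l ?mulr_ge0 ?(ltW t0) ?(ltW eps0)// ler_nat.
have -> : expR (2 * (t * K)) = expR (t * K) * expR (t * K) by rewrite -expRD; congr expR; ring.
rewrite exprMn; set a := rho ^+ n; set b := expR (t * K).
have -> : b * b * (a * expR (- (t * eps)) ^+ n) = expR (- (t * eps)) ^+ n * (a * b * b) by ring.
by rewrite ler_pM// ?mulr_ge0 ?expR_ge0 ?exprn_ge0 ?(ltW rho0)//
  ler_wpM2l// mulr_ge0 ?expR_ge0// exprn_ge0 ?(ltW rho0).
Qed.

(** Both signs and all the states are covered by finitely many mean zero functions. *)
Lemma occupation_large (eps : R) : 0 < eps ->
  exists C r : R, [/\ 0 <= C, 0 <= r, r < 1 & forall n i,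
  (\esum_(xs in [set xs | size xs = n /\ exists s : 'Z_m,
       (eps * n.+1%:R < `|path_sum (fun s' => (s' == s)%:R - fuzzy_stationary d l s) i xs|)%R])
     (path_weight Q (unfold_Z l) i xs)%:E <= (C * r ^+ n)%:E)%E].
Proof.
move=> eps0; pose f (bs : bool * 'Z_m) (s : 'Z_m) : R :=
  (-1) ^+ bs.1 * ((s == bs.2)%:R - fuzzy_stationary d l bs.2).
have f_mean0 bs : \sum_s fuzzy_stationary d l s * f bs s = 0.
  under eq_bigr do rewrite mulrCA mulrBr.
  rewrite -mulr_sumr sumrB -mulr_suml fuzzy_stationary_sum1// mul1r.
  rewrite (bigD1 bs.2)//= eqxx mulr1 big1 ?addr0 ?subrr ?mulr0// => s /negPf ->.
  by rewrite mulr0.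
have fE bs i xs : path_sum (f bs) i xs = (-1) ^+ bs.1 *
    path_sum (fun s' => (s' == bs.2)%:R - fuzzy_stationary d l bs.2) i xs.
  elim: xs i => [|x xs IH] i /=; first by rewrite !addr0.
  by rewrite IH mulrDr.
have bound bs := cid (path_sum_large (f_mean0 bs) eps0).
have bound2 bs := cid (projT2 (bound bs)).
pose C bs := projT1 (bound bs); pose r bs := projT1 (bound2 bs).
have CrP bs : [/\ 0 <= C bs, 0 <= r bs, r bs < 1 & forall n i,
  (\esum_(xs in [set xs | size xs = n /\ (eps * n.+1%:R < path_sum (f bs) i xs)%R])
     (path_weight Q (unfold_Z l) i xs)%:E <= (C bs * r bs ^+ n)%:E)%E] := projT2 (bound2 bs).
have w0 i xs : 0 <= path_weight Q (unfold_Z l) i xs by rewrite ltW// path_weight_gt0.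
exists (\sum_bs C bs), (\big[Num.max/0]_bs r bs); split.
- by apply: sumr_ge0 => bs _; have [] := CrP bs.
- exact: bigmax_ge_id.
- by apply/bigmax_ltP; split => // bs _; have [] := CrP bs.
move=> n i; apply: (@le_trans _ _ (\esum_(xs in [set xs | exists bs,
    size xs = n /\ (eps * n.+1%:R < path_sum (f bs) i xs)%R])
    (path_weight Q (unfold_Z l) i xs)%:E)%E).
  apply: subset_esum => [xs|xs [sxs [s]]]; first by rewrite lee_fin.
  rewrite ltr_normr => /orP[]large; [exists (false, s)|exists (true, s)]; split=> //.
    by rewrite fE /= mul1r.
  by rewrite fE /= expr1 mulN1r.
apply: le_trans (esum_union_le _ _) _; first by move=> xs; rewrite lee_fin.
rewrite mulr_suml -sumEFin; apply: lee_sum => bs _.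
have [C0 r0 _ Cr] := CrP bs; apply: le_trans (Cr n i) _.
rewrite lee_fin ler_wpM2l// lerXn2r ?nnegrE ?bigmax_ge_id//.
exact: le_bigmax.
Qed.

End deviations.

Lemma path_sumE (R : realType) (m : nat) (f : 'Z_m -> R) i xs : path_sum f i xs =
  \sum_(k < (size xs).+1) f (i + \sum_(j < k) nth 0 xs j)%:~R.
Proof.
elim: xs i => [|x xs IH] i /=; rewrite big_ord_recl big_ord0 !addr0 ?big_ord0 ?addr0//.
rewrite IH; congr (_ + _); apply: eq_bigr => k _.
by rewrite big_ord_recl /= addrA.
Qed.

(** * Marginals of the gradient Gibbs measure along a path *)

Section path_marginals.
Context {R : realType} {V : choiceType} (adj : rel V) (b : nat -> V).
Hypothesis irr_adj : irreflexive adj.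
Hypothesis sym_adj : symmetric adj.
Hypothesis acyc : acyclic_graph adj.
Hypothesis bP : infinite_path adj b.

Definition path_cylinder (xs : seq int) : set (gradient_space adj) :=
  [set eta | forall i, (i < size xs)%N -> gval eta (b i) (b i.+1) = nth 0 xs i].

Let increment_along (xs : seq int) (x y : V) : int :=
  if pselect (exists i, x = b i /\ y = b i.+1) is left ex
  then nth 0 xs (projT1 (cid ex)) else 0.

(** Subtracting the two orientations makes the field antisymmetric; on an edge of
    the path only one of the two terms survives, as [b] is injective. *)
Lemma path_gradient_proof xs :
  (fun x y => increment_along xs x y - increment_along xs y x) \in gradients adj.
Proof.
rewrite inE; split=> [x y|x y nxy]; first by rewrite opprB.
rewrite /increment_along; case: pselect => [[i [ex ey]]|_]; last first.
  case: pselect => [[i [ey ex]]|_]; last by rewrite subrr.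
  by exfalso; move: nxy; rewrite ex ey sym_adj bP.1.
by exfalso; move: nxy; rewrite ex ey bP.1.
Qed.

(** A configuration with prescribed increments along the path: the marginals are
    given on cylinders around a configuration. *)
Definition path_gradient xs : gradient_config adj :=
  exist (fun z : V -> V -> int => z \in gradients adj) _ (path_gradient_proof xs).

Lemma path_gradientE xs i : gval (path_gradient xs) (b i) (b i.+1) = nth 0 xs i.
Proof.
rewrite -[LHS]/(increment_along xs (b i) (b i.+1) - increment_along xs (b i.+1) (b i)).
have -> : increment_along xs (b i.+1) (b i) = 0.
  rewrite /increment_along; case: pselect => // ex; exfalso.
  by case: ex => j [/bP.2 e1 /bP.2 e2]; lia.
rewrite subr0 /increment_along; case: pselect => [ex|nex].
  by have [/bP.2 <- _] := projT2 (cid ex).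
by exfalso; apply: nex; exists i.
Qed.

Lemma gval_antisym (eta : gradient_config adj) x y : gval eta x y = - gval eta y x.
Proof. by have [anti _] := set_valP eta; exact: anti. Qed.

Lemma gval_nonadj (eta : gradient_config adj) x y : ~~ adj x y -> gval eta x y = 0.
Proof. by have [_ zero] := set_valP eta; exact: zero. Qed.

Section segment.
Variable n : nat.

Definition segment_fset : {fset V} := [fset b (val i) | i in 'I_n.+1]%fset.

Lemma segment_fsetP x : reflect (exists2 i, (i <= n)%N & x = b i) (x \in segment_fset).
Proof.
apply: (iffP idP) => [/imfsetP[i _ ->]|[i ilen ->]].
  by exists i => //; rewrite -ltnS.
by apply/imfsetP; exists (Ordinal (ilen : (i < n.+1)%N)).
Qed.

Lemma segment_root_in : b 0 \in segment_fset.
Proof. by apply/segment_fsetP; exists 0%N. Qed.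

Definition segment_vertex (i : nat) : segment_fset :=
  insubd [` segment_root_in]%fset (b i).

Lemma segment_vertexK i : (i <= n)%N -> fsval (segment_vertex i) = b i.
Proof. by move=> ilen; rewrite insubdK//; apply/segment_fsetP; exists i. Qed.

Lemma segment_vertex_surj (v : segment_fset) :
  exists2 i, (i <= n)%N & v = segment_vertex i.
Proof.
have /segment_fsetP[i ilen vi] := fsvalP v; exists i => //.
by apply: val_inj; rewrite /= segment_vertexK.
Qed.

Lemma segment_connected : connected_in adj segment_fset.
Proof.
move=> _ _ /segment_fsetP[i ilen ->] /segment_fsetP[j jlen ->].
have [ij|/ltnW ji] := leqP i j.
  exists [seq b k | k <- iota i.+1 (j - i)]; split.
  - exact: path_segment.
  - move=> _ /mapP[k + ->]; rewrite mem_iota => kij.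
    by apply/segment_fsetP; exists k => //; lia.
  - by rewrite last_segment subnKC.
exists [seq b (i - k)%N | k <- iota 1 (i - j)].
have gen u : forall t, (u + t <= i)%N ->
    path adj (b (i - u)%N) [seq b (i - k)%N | k <- iota u.+1 t] /\
    last (b (i - u)%N) [seq b (i - k)%N | k <- iota u.+1 t] = b (i - (u + t))%N.
  move=> t; elim: t u => [|t IH] u ut; first by rewrite addn0.
  have [|IH1 IH2] := IH u.+1; first by lia.
  split=> /=; last by rewrite IH2 addSnnS.
  rewrite IH1 andbT sym_adj.
  have -> : (i - u = (i - u.+1).+1)%N by lia.
  exact: bP.1.
have [|g1 g2] := gen 0%N (i - j)%N; first by lia.
rewrite subn0 in g1 g2; split=> //; last by rewrite g2; congr b; lia.
move=> _ /mapP[k + ->]; rewrite mem_iota => kij.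
by apply/segment_fsetP; exists (i - k)%N => //; lia.
Qed.

Lemma prod_away_edges (F : segment_fset * segment_fset -> R) :
  \prod_(e : segment_fset * segment_fset |
     `[< away_from adj (fsval (segment_vertex 0)) (fsval e.1) (fsval e.2) >]) F e =
  \prod_(i < n) F (segment_vertex i, segment_vertex i.+1).
Proof.
pose h (i : 'I_n) := (segment_vertex i, segment_vertex i.+1).
have h_inj : injective h.
  move=> i j [/(congr1 (fun v => fsval v)) + _]; rewrite !segment_vertexK ?(ltnW (ltn_ord _))//.
  by move=> /bP.2 /val_inj.
rewrite -(big_imset F (A := 'I_n) (h := h)) /=; last by move=> i j _ _; exact: h_inj.
apply: eq_bigl => -[x y] /=.
have [i ilen ->] := segment_vertex_surj x; have [j jlen ->] := segment_vertex_surj y.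
rewrite !segment_vertexK// away_from_pathE//.
apply/eqP/imsetP => [ej|[k _ [/(congr1 (fun v => fsval v)) + /(congr1 (fun v => fsval v))]]].
  by rewrite ej in jlen *; exists (Ordinal jlen).
by rewrite !segment_vertexK ?(ltnW (ltn_ord _))// => /bP.2 -> /bP.2 ->.
Qed.

End segment.

Lemma cylinder_segment xs :
  cylinder (segment_fset (size xs)) (path_gradient xs) = path_cylinder xs.
Proof.
apply/seteqP; split=> eta /= eq_eta.
  move=> i ilt; rewrite eq_eta ?path_gradientE//; apply/segment_fsetP.
    by exists i => //; exact: ltnW.
  by exists i.+1.
move=> _ _ /segment_fsetP[i ilen ->] /segment_fsetP[j jlen ->].
have [|nij] := boolP (adj (b i) (b j)); last by rewrite !gval_nonadj.
rewrite path_adjE// => /orP[/eqP ej|/eqP ei].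
  by subst j; rewrite eq_eta// path_gradientE.
by subst i; rewrite gval_antisym [RHS]gval_antisym eq_eta// path_gradientE.
Qed.

Context (d : nat) (Q : int -> R) (q : nat) (l : 'Z_q -> R).
Hypothesis Q_transfer : transfer_operator Q.
Hypothesis l_gt0 : forall s, 0 < l s.

Lemma prod_path_weight (lam : int -> R) i xs :
  path_weight Q lam i xs = \prod_(k < size xs)
    step_weight Q lam (i + \sum_(j < k) nth 0 xs j) (nth 0 xs k).
Proof.
elim: xs i => [|x xs IH] i /=; first by rewrite big_ord0.
rewrite big_ord_recl big_ord0 addr0 IH; congr (_ * _); apply: eq_bigr => k _.
by rewrite big_ord_recl /= addrA.
Qed.

(** Given the class of the height at [b 0], the increments determine the classes
    of all the heights, so only one term of the sum over the fuzzy chain survives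
    for each initial class; along it the factors [fuzzy_Q] cancel. *)
Lemma gibbs_path_cylinder (nu : set (gradient_space adj) -> \bar R) :
  gradient_gibbs d Q l nu -> forall xs,
  nu (path_cylinder xs) = (\sum_(s : 'Z_q) fuzzy_stationary d l s *
    path_weight Q (unfold_Z l) (val s)%:Z xs)%:E.
Proof.
move=> gibbs xs; pose n := size xs; pose L := segment_fset n.
have := gibbs L (segment_vertex n 0) (path_gradient xs) (@segment_connected n).
rewrite cylinder_segment => ->; congr EFin.
pose pos (v : L) := index (fsval v) [seq b k | k <- iota 0 n.+1].
have posE i : (i <= n)%N -> pos (segment_vertex n i) = i.
  move=> ilen; rewrite /pos segment_vertexK// index_map; last exact: bP.2.
  rewrite -{1}[i]add0n -(@nth_iota 0%N 0 n.+1 i)//.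
  by rewrite index_uniq ?size_iota ?iota_uniq.
pose H k : int := \sum_(j < k) nth 0 xs j.
pose lift (s : 'Z_q) : {ffun L -> 'Z_q} := [ffun v => s + (H (pos v))%:~R].
have liftE s i : (i <= n)%N -> lift s (segment_vertex n i) = s + (H i)%:~R.
  by move=> ilen; rewrite ffunE posE.
(* Other configurations contradict the increments across some edge. *)
rewrite (bigID (fun sigma : {ffun L -> 'Z_q} => sigma == lift (sigma (segment_vertex n 0)))) /=.
rewrite [X in _ + X]big1 ?addr0; last first.
  move=> sigma; apply: contraNeq; rewrite mulf_eq0 negb_or => /andP[_].
  rewrite prod_away_edges prodf_seq_neq0 => /allP nz.
  have step i : (i < n)%N -> sigma (segment_vertex n i.+1) =
      sigma (segment_vertex n i) + (nth 0 xs i)%:~R.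
    move=> ilt; have := nz (Ordinal ilt); rewrite mem_index_enum => /(_ isT) /=.
    rewrite /increment_law /= !segment_vertexK ?(ltnW ilt)// path_gradientE.
    case: (_%:~R =P _) => [-> _|_]; last by rewrite mul0r eqxx.
    by rewrite addrC subrK.
  apply/eqP/ffunP => v; have [i + ->] := segment_vertex_surj v.
  elim: i => [|i IH] ilen; first by rewrite liftE// /H big_ord0 addr0.
  rewrite step// IH ?(ltnW ilen)// !liftE ?(ltnW ilen)//.
  by rewrite /H big_ord_recr /= intrD addrA.
rewrite (reindex_onto lift (fun sigma : {ffun L -> 'Z_q} => sigma (segment_vertex n 0))) /=;
  last first.
  by move=> sigma /eqP <-.
have lift0 s : lift s (segment_vertex n 0) = s by rewrite liftE// /H big_ord0 addr0.
apply: eq_big => [s|s _]; first by rewrite lift0 !eqxx.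
rewrite /fuzzy_chain_law lift0 -mulrA; congr (_ * _).
rewrite !prod_away_edges -big_split prod_path_weight; apply: eq_bigr => i _ /=.
rewrite !segment_vertexK ?(ltnW (ltn_ord i))// path_gradientE !liftE ?(ltnW (ltn_ord i))//.
have -> : H i.+1 = H i + nth 0 xs i by rewrite /H big_ord_recr.
rewrite -/(H i); set x := nth 0 xs i.
have -> : s + (H i)%:~R = ((val s)%:Z + H i)%:~R by rewrite intrD natr_residue.
have -> : s + (H i + x)%:~R = ((val s)%:Z + H i + x)%:~R.
  by rewrite !intrD natr_residue addrA.
rewrite (fuzzy_transitionE Q_transfer l_gt0) -!intrB /increment_law /step_weight.
have -> : (val s)%:Z + H i - ((val s)%:Z + H i + x) = - x by ring.
have -> : (val s)%:Z + H i + x - ((val s)%:Z + H i) = x by ring.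
rewrite eqxx mul1r intrN fuzzy_Q_even//.
have : fuzzy_Q Q (x%:~R : 'Z_q) != 0 by rewrite gt_eqF// fuzzy_Q_gt0.
have : normalization Q (unfold_Z l) ((val s)%:Z + H i) != 0.
  by rewrite gt_eqF// normalization_gt0.
rewrite /unfold_Z => N0 F0; by field; rewrite N0 F0.
Qed.

End path_marginals.

(** * Almost sure convergence of the empirical distribution *)

Section countable_unions.
Context {d : measure_display} {X : measurableType d} {R : realType}.
Variable mu : {measure set X -> \bar R}.
Variables (T : countType) (A : set T) (F : T -> set X).
Hypothesis F_measurable : forall t, measurable (F t).

Let G (k : nat) : set X := if (pickle_inv k : option T) is Some t then
  if t \in A then F t else set0 else set0.

Let bigcup_G : \bigcup_(t in A) F t = \bigcup_k G k.
Proof.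
apply/seteqP; split=> x [].
  by move=> t At Ftx; exists (choice.pickle t) => //; rewrite /G pickleK_inv mem_set.
move=> k _; rewrite /G; case: pickle_inv => [t|]; last by case.
by case: ifPn => [/[!inE] At Ftx|_]; [exists t|case].
Qed.

Let G_measurable k : measurable (G k).
Proof. by rewrite /G; case: pickle_inv => // t; case: ifP. Qed.

Lemma countable_bigcup_measurable : measurable (\bigcup_(t in A) F t).
Proof. by rewrite bigcup_G; exact: bigcupT_measurable. Qed.

Lemma measure_bigcup_le_esum :
  (mu (\bigcup_(t in A) F t) <= \esum_(t in A) mu (F t))%E.
Proof.
apply: (@le_trans _ _ (\sum_(k <oo) mu (G k))%E).
  apply: measure_sigma_subadditive => //; first exact: countable_bigcup_measurable.
  by rewrite bigcup_G.
rewrite nneseries_esumT//.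
have -> : (\esum_(k in [set: nat]) mu (G k) =
           \esum_(k in choice.pickle @` A) mu (G k))%E.
  rewrite [RHS]esum_mkcond; apply: eq_esum => k _; case: ifPn => // nAk.
  rewrite /G; have := @pickle_invK T k; case: pickle_inv => [t /= tk|_]; last by rewrite measure0.
  case: ifPn => [/[!inE] At|_]; last by rewrite measure0.
  by exfalso; move/negP: nAk; apply; rewrite inE; exists t.
rewrite (@reindex_esum _ _ _ A (choice.pickle @` A) choice.pickle); last first.
  by split=> [t At|t u _ _ /(pcan_inj choice.pickleK)|k]//; exists t.
by apply: le_esum => t At; rewrite /G pickleK_inv mem_set.
Qed.

End countable_unions.

Lemma nneseries_geometric_lty (R : realType) (C r : R) (a : nat -> \bar R) :
  0 <= C -> 0 <= r -> r < 1 -> (forall n, (0 <= a n)%E) ->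
  (forall n, (a n <= (C * r ^+ n)%:E)%E) -> (\sum_(n <oo) a n < +oo)%E.
Proof.
move=> C0 r0 r1 a0 aCr.
apply: (@le_lt_trans _ _ (C / (1 - r))%:E); last exact: ltry.
apply: lime_le; first by apply: is_cvg_nneseries => n _ _.
apply: nearW => n; apply: (@le_trans _ _ (series (geometric C r) n)%:E).
  by rewrite /series /= -sumEFin; apply: lee_sum => k _.
rewrite geometric_seriesE ?lt_eqF// lee_fin ler_wpM2r ?invr_ge0 ?subr_ge0 ?(ltW r1)//.
by rewrite ler_piMr// lerBlDr lerDl exprn_ge0.
Qed.

Section fold_law.
Context {R : realType} (Q : int -> R) (d q M : nat) (l : 'Z_q -> R).
Hypothesis q_gt1 : (1 < q)%N.
Hypothesis M_gt1 : (1 < M)%N.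
Hypothesis qM : (q %| M)%N.

Lemma unfold_fold : unfold_Z (fold_Z M (unfold_Z l)) = unfold_Z l.
Proof. by apply: fold_ZK => //; apply: periodic_dvd qM _; exact: periodic_unfold. Qed.

Lemma fold_boundary_law : periodic_boundary_law d Q q (unfold_Z l) ->
  periodic_boundary_law d Q M (unfold_Z (fold_Z M (unfold_Z l))).
Proof.
case=> per l0 claw; split; rewrite unfold_fold//.
exact: periodic_dvd qM per.
Qed.

End fold_law.

Lemma path_sum_shift (R : realType) (m : nat) (f : 'Z_m -> R) i j xs :
  path_sum f (i + j) xs = path_sum (fun s => f (s + i%:~R)) j xs.
Proof.
rewrite !path_sumE; apply: eq_bigr => k _; congr f.
by rewrite -intrD; congr (_%:~R); ring.
Qed.

Lemma stationary_in_simplex (R : realType) (d m : nat) (l : 'Z_m -> R) :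
  (forall s, 0 < l s) ->
  \row_(s < (Zp_trunc m).+2) fuzzy_stationary d l s \in simplex R m.
Proof.
move=> l0; rewrite inE; split=> [s|]; first by rewrite mxE ltW// fuzzy_stationary_gt0.
by under eq_bigr do rewrite mxE; rewrite fuzzy_stationary_sum1.
Qed.

Definition stationary_simplex (R : realType) (d m : nat) (l : 'Z_m -> R)
    (l0 : forall s, 0 < l s) : simplex R m :=
  exist (fun v : 'rV[R]_(Zp_trunc m).+2 => v \in simplex R m) _
    (stationary_in_simplex d l0).

Lemma stationary_simplexE (R : realType) (d m : nat) (l : 'Z_m -> R) l0 s :
  set_val (@stationary_simplex R d m l l0) 0 s = fuzzy_stationary d l s.
Proof. by rewrite /set_val /= mxE. Qed.

Lemma empiricalE (R : realType) (m : nat) (H : nat -> int) n (s : 'Z_m) :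
  set_val (empirical m H n : simplex R m) 0 s =
  (\sum_(i < n.+1) ((H i)%:~R == s :> 'Z_m)%:R) / n.+1%:R.
Proof. by rewrite /set_val /= mxE. Qed.

Section ergodic_limit.
Context {R : realType} {V : choiceType} (adj : rel V) (b : nat -> V).
Hypothesis irr_adj : irreflexive adj.
Hypothesis sym_adj : symmetric adj.
Hypothesis acyc : acyclic_graph adj.
Hypothesis bP : infinite_path adj b.
Context (d : nat) (Q : int -> R) (q M : nat) (l : 'Z_q -> R).
Hypothesis d_gt0 : (0 < d)%N.
Hypothesis Q_transfer : transfer_operator Q.
Hypothesis q_gt1 : (1 < q)%N.
Hypothesis law : periodic_boundary_law d Q q (unfold_Z l).
Variable nu : probability (gradient_space adj) R.
Hypothesis gibbs : gradient_gibbs d Q l nu.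
Hypothesis M_gt1 : (1 < M)%N.
Hypothesis qM : (q %| M)%N.

Let l_gt0 s : 0 < l s.
Proof. by have [_ + _] := law => /(_ (val s)%:Z); rewrite /unfold_Z natr_residue. Qed.

Let lM := fold_Z M (unfold_Z l).

Let lM_gt0 s : 0 < lM s. Proof. exact: l_gt0. Qed.

Let law_M : periodic_boundary_law d Q M (unfold_Z lM).
Proof. exact: fold_boundary_law. Qed.

Lemma path_cylinder_measurable xs : measurable (@path_cylinder V adj b xs).
Proof.
have -> : @path_cylinder V adj b xs = \bigcap_(i in `I_(size xs))
    [set eta | gval eta (b i) (b i.+1) = nth 0 xs i].
  by apply/seteqP; split=> eta /= h i; exact: h.
apply: bigcap_measurableType => // i _; apply: sub_sigma_algebra.
by exists (b i), (b i.+1), (nth 0 xs i).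
Qed.

(* The shift [a] is quantified because the class of the initial height is not
   observed. *)
Let atypical (eps : R) (n : nat) : set (seq int) :=
  [set xs | size xs = n /\ forall a : 'Z_M, exists s : 'Z_M,
    eps * n.+1%:R <
    `|path_sum (fun s' => (s' == s)%:R - fuzzy_stationary d lM (s + a)) 0 xs|].

Let atypical_event eps n : set (gradient_space adj) :=
  \bigcup_(xs in atypical eps n) path_cylinder b xs.

Let atypical_event_measurable eps n : measurable (atypical_event eps n).
Proof. by apply: countable_bigcup_measurable => xs; exact: path_cylinder_measurable. Qed.

(** The unknown class of the initial height only shifts the empirical
    distribution, so a word that is atypical up to shifts is atypical for the
    chain started from any class. *)
Let atypical_event_small eps : 0 < eps -> exists C r : R,
  [/\ 0 <= C, 0 <= r, r < 1 &
      forall n, (nu (atypical_event eps n) <= (C * r ^+ n)%:E)%E].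
Proof.
move=> eps0.
have [C [r [C0 r0 r1 Cr]]] := occupation_large Q_transfer lM_gt0 d_gt0 law_M eps0.
exists C, r; split=> // n.
have w0 i xs : 0 <= path_weight Q (unfold_Z l) i xs by rewrite ltW// path_weight_gt0.
have p0 s : 0 <= fuzzy_stationary d l s by rewrite ltW// fuzzy_stationary_gt0.
apply: le_trans (measure_bigcup_le_esum _ _ path_cylinder_measurable) _.
rewrite (eq_esum (b := fun xs => \sum_(s : 'Z_q) ((fuzzy_stationary d l s)%:E *
    (path_weight Q (unfold_Z l) (val s)%:Z xs)%:E)%E)); last first.
  move=> xs _; rewrite [LHS](gibbs_path_cylinder irr_adj sym_adj acyc bP Q_transfer l_gt0 gibbs).
  by rewrite -sumEFin.
rewrite esum_sum; last by move=> xs s _ _; rewrite -EFinM lee_fin mulr_ge0.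
apply: (@le_trans _ _ (\sum_(s : 'Z_q) (fuzzy_stationary d l s * (C * r ^+ n))%:E)%E).
  apply: lee_sum => s _; rewrite esumZl//; last by move=> xs; rewrite lee_fin.
  rewrite [leRHS]EFinM; apply: lee_wpmul2l; first by rewrite lee_fin.
  have := Cr n (val s)%:Z; rewrite unfold_fold//; apply: le_trans.
  apply: subset_esum => [xs|xs [sxs atyp]]; first by rewrite lee_fin.
  split=> //; have [s' large] := atyp (val s)%:Z%:~R.
  exists (s' + (val s)%:Z%:~R); apply: lt_le_trans large _.
  set f := (X in _ <= `|path_sum X _ _|).
  have := path_sum_shift f (val s)%:Z 0 xs; rewrite addr0 => ->; rewrite {}/f.
  suff -> : (fun r' : 'Z_M => (r' + (val s)%:Z%:~R == s' + (val s)%:Z%:~R)%:R -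
      fuzzy_stationary d lM (s' + (val s)%:Z%:~R)) =
      (fun r' => (r' == s')%:R - fuzzy_stationary d lM (s' + (val s)%:Z%:~R)) by [].
  by apply/funext => r'; rewrite (inj_eq (addIr _)).
by rewrite sumEFin -mulr_suml fuzzy_stationary_sum1// mul1r.
Qed.

(** Borel-Cantelli for the atypical events at each precision; the prescribed
    height at the [k]-th vertex adds one more shift. *)
Lemma empirical_orbit_cvg k h : {ae nu, forall eta : gradient_space adj,
  orbit_cvg (fun n => empirical M (path_height b k h eta) n)
            (stationary_simplex d lM_gt0)}.
Proof.
have ae_eps j : {ae nu, forall eta, exists N, forall n, (N <= n)%N ->
    ~ atypical_event j.+1%:R^-1 n eta}.
  have [//|C [r [C0 r0 r1 Cr]]] := @atypical_event_small j.+1%:R^-1.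
  exists (lim_sup_set (atypical_event j.+1%:R^-1)); split.
  - by apply: bigcap_measurable => // n _; apply: bigcup_measurable.
  - by apply: lim_sup_set_cvg0 => //; exact: nneseries_geometric_lty Cr.
  move=> eta /= nev n _; apply: contrapT => none; apply: nev; exists n => i ni Ei.
  by apply: none; exists i.
have := ae_foralln ae_eps; apply: filterS => eta typical eps eps0.
have [j jeps] : exists j, j.+1%:R^-1 < eps.
  by have [j] := ltr_add_invr eps0; rewrite add0r; exists j.
have [N Ntyp] := typical j; exists N => // n /= /Ntyp ntyp.
pose xs := mkseq (fun i => gval eta (b i) (b i.+1)) n.
have {}ntyp : ~ atypical j.+1%:R^-1 n xs.
  move=> atyp; apply: ntyp; exists xs => // i; rewrite size_mkseq => ilt.
  by rewrite nth_mkseq.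
have [a close] : exists a : 'Z_M, forall s : 'Z_M,
    `|path_sum (fun s' => (s' == s)%:R - fuzzy_stationary d lM (s + a)) 0 xs| <=
    j.+1%:R^-1 * n.+1%:R.
  apply: contrapT => none; apply: ntyp; split; first exact: size_mkseq.
  move=> a; apply: contrapT => nones; apply: none; exists a => s.
  by rewrite leNgt; apply/negP => lt; apply: nones; exists s.
pose c := h - \sum_(i < k) gval eta (b i) (b i.+1).
exists (a - c%:~R) => s; rewrite stationary_simplexE empiricalE.
rewrite (le_lt_trans _ jeps)//; have := close (s - c%:~R).
rewrite path_sumE size_mkseq sumrB sumr_const card_ord.
have -> : s - c%:~R + a = s + (a - c%:~R) by rewrite addrAC addrA.
have -> : \sum_(i < n.+1) ((0 + \sum_(j0 < i) nth 0 xs j0)%:~R == s - c%:~R)%:R =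
    \sum_(i < n.+1) ((path_height b k h eta i)%:~R == s)%:R :> R.
  apply: eq_bigr => i _; congr (_%:R); rewrite eq_sym subr_eq eq_sym -intrD.
  congr (_%:~R == s); rewrite /path_height /c add0r.
  have -> : \sum_(j0 < i) nth 0 xs j0 = \sum_(j0 < i) gval eta (b j0) (b j0.+1).
    apply: eq_bigr => j0 _; rewrite nth_mkseq// (leq_trans (ltn_ord j0))//.
    by rewrite -ltnS.
  ring.
rewrite -ler_pdivrMr ?ltr0n//; apply: le_trans.
set S := \sum_(_ < _) _; set p := fuzzy_stationary _ _ _.
have -> : S / n.+1%:R - p = (S - p *+ n.+1) / n.+1%:R.
  by rewrite -mulr_natr; field; rewrite ?pnatr_eq0.
by rewrite normrM normfV (@ger0_norm _ n.+1%:R).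
Qed.

End ergodic_limit.

(** * Projection to a divisor, shifts and multiples of a law *)

Section projection.
Context {R : realType} (m M : nat).
Hypothesis m_gt1 : (1 < m)%N.
Hypothesis M_gt1 : (1 < M)%N.
Hypothesis mM : (m %| M)%N.

Definition reduce (s : 'Z_M) : 'Z_m := (val s)%:Z%:~R.

Lemma reduce_residue (i : int) : reduce i%:~R = i%:~R.
Proof.
rewrite /reduce; have [k ik] := val_residue i M_gt1.
rewrite [in RHS]ik; have [c ->] := dvdnP mM.
by rewrite PoszM mulrAC mulrC residue_shift.
Qed.

Lemma reduceD s a : reduce (s + a) = reduce s + reduce a.
Proof. by rewrite -(natr_residue s) -(natr_residue a) -intrD !reduce_residue intrD. Qed.

Lemma reduce_in_simplex (u : simplex R M) :
  \row_(t < (Zp_trunc m).+2) (\sum_(s : 'Z_M | reduce s == t) set_val u 0 s)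
    \in simplex R m.
Proof.
have [u0 u1] := set_valP u; rewrite inE; split=> [t|].
  by rewrite mxE sumr_ge0.
under eq_bigr do rewrite mxE; rewrite -u1.
by rewrite [RHS](partition_big reduce xpredT).
Qed.

Definition reduce_simplex (u : simplex R M) : simplex R m :=
  exist (fun v : 'rV[R]_(Zp_trunc m).+2 => v \in simplex R m) _ (reduce_in_simplex u).

Lemma reduce_simplexE u t : set_val (reduce_simplex u) 0 t =
  \sum_(s : 'Z_M | reduce s == t) set_val u 0 s.
Proof. by rewrite /set_val /= mxE. Qed.

Lemma orbit_cvg_reduce (H : nat -> int) (u : simplex R M) :
  orbit_cvg (fun n => empirical M H n) u ->
  orbit_cvg (fun n => empirical m H n) (reduce_simplex u).
Proof.
(* One more than the number of residues, to keep the inequality strict. *)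
move=> Hu eps eps0; pose N : R := #|'Z_M|.+1%:R.
have N0 : 0 < N by rewrite ltr0n.
have := Hu _ (divr_gt0 eps0 N0); apply: filterS => n [a na].
exists (reduce a) => t; rewrite empiricalE reduce_simplexE.
rewrite (reindex_inj (addIr a)) /=.
rewrite (eq_bigl (fun s : 'Z_M => reduce s == t)); last first.
  by move=> s; rewrite reduceD (inj_eq (addIr _)).
have -> : (\sum_(i < n.+1) ((H i)%:~R == t)%:R) / n.+1%:R =
    \sum_(s : 'Z_M | reduce s == t) set_val (empirical M H n : simplex R M) 0 s.
  under [RHS]eq_bigr do rewrite empiricalE.
  rewrite -mulr_suml exchange_big /=; congr (_ / _); apply: eq_bigr => i _.
  have [Hit|Hit] := eqVneq ((H i)%:~R : 'Z_m) t.
    rewrite (bigD1 ((H i)%:~R : 'Z_M)) ?reduce_residue ?Hit//= eqxx.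
    by rewrite big1 ?addr0// => s /andP[_ /negPf]; rewrite eq_sym => ->.
  rewrite big1// => s /eqP st; case: eqP => // Hs.
  by move: Hit; rewrite -st -Hs reduce_residue eqxx.
rewrite -sumrB (le_lt_trans (ler_norm_sum _ _ _))//.
apply: (@le_lt_trans _ _ (\sum_(s : 'Z_M) eps / N)).
  rewrite [leRHS](bigID (fun s => reduce s == t)) /= -[leLHS]addr0 lerD//.
    by apply: ler_sum => s _; rewrite ltW.
  by apply: sumr_ge0 => s _; rewrite divr_ge0 ?ltW.
rewrite sumr_const -mulr_natr mulrAC ltr_pdivrMr// ltr_pM2l// ltr_nat.
exact: ltnSn.
Qed.

End projection.

Section affine_change.
Context {R : realType} (d : nat) (Q : int -> R) (q : nat) (l : 'Z_q -> R).
Hypothesis Q_transfer : transfer_operator Q.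
Hypothesis q_gt1 : (1 < q)%N.
Hypothesis l_gt0 : forall s, 0 < l s.
Variables (K : R) (a : 'Z_q).
Hypothesis K_gt0 : 0 < K.

Let l' (s : 'Z_q) := K * l (s + a).

(** The factor [K] is absorbed by the constant of the boundary law equation. *)
Lemma boundary_law_affine : periodic_boundary_law d Q q (unfold_Z l) ->
  periodic_boundary_law d Q q (unfold_Z l').
Proof.
case=> _ _ [c c0 claw]; split; first exact: periodic_unfold.
  by move=> i; rewrite mulr_gt0.
exists (K * c / K ^+ d); first by rewrite divr_gt0 ?exprn_gt0// mulr_gt0.
move=> i; have := claw (i + (val a)%:Z); rewrite esum_normalization//.
have -> : (\esum_(j in [set: int]) (Q (i - j) * unfold_Z l' j)%:E =
    K%:E * \esum_(j in [set: int]) (Q (i + (val a)%:Z - j) * unfold_Z l j)%:E)%E.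
  rewrite -esumZl ?ltW//; last first.
    by have [Q0 _ _] := Q_transfer => j; rewrite lee_fin mulr_ge0// ltW//; exact: l_gt0.
  rewrite [RHS](@reindex_esum _ _ _ [set: int] _ (fun j => j + (val a)%:Z)); last first.
    split=> // [x y _ _ /addIr//|x _]; by exists (x - (val a)%:Z); rewrite ?subrK.
  apply: eq_esum => j _; rewrite -EFinM /unfold_Z /l' intrD natr_residue.
  by congr EFin; rewrite mulrCA; congr (_ * (Q _ * _)); ring.
rewrite esum_normalization// -!EFinM -!EFin_expe -!EFinM => -[].
rewrite /unfold_Z /l' intrD natr_residue => ->; congr EFin.
by rewrite exprMn; field; rewrite expf_neq0// gt_eqF.
Qed.

Lemma fuzzy_stationary_affine s : fuzzy_stationary d l' s = fuzzy_stationary d l (s + a).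
Proof.
rewrite /fuzzy_stationary /l' powRM ?ltW//.
have -> : \sum_j (K * l (j + a)) `^ (d.+1%:R / d%:R) =
    K `^ (d.+1%:R / d%:R) * \sum_j l j `^ (d.+1%:R / d%:R).
  rewrite [in RHS](reindex_inj (addIr a)) mulr_sumr.
  by apply: eq_bigr => j _; rewrite powRM ?ltW.
by rewrite -mulf_div divff ?mul1r// gt_eqF// powR_gt0.
Qed.

Lemma fuzzy_transition_affine s r :
  fuzzy_transition Q l' s r = fuzzy_transition Q l (s + a) (r + a).
Proof.
have shift t u : t + a - (u + a) = t - u :> 'Z_q by rewrite opprD addrACA subrr addr0.
rewrite /fuzzy_transition /l' shift.
have -> : \sum_t fuzzy_Q Q (s - t) * (K * l (t + a)) =
    K * \sum_t fuzzy_Q Q (s + a - t) * l t.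
  rewrite [in RHS](reindex_inj (addIr a)) mulr_sumr.
  by apply: eq_bigr => j _; rewrite shift mulrCA.
by rewrite mulrCA -mulf_div divff ?mul1r// gt_eqF.
Qed.

(** Shifting every class by [a] permutes the fuzzy configurations and preserves
    their differences, on which alone the increments depend. *)
Lemma gradient_gibbs_affine (V : choiceType) (adj : rel V)
    (nu : set (gradient_space adj) -> \bar R) :
  gradient_gibbs d Q l nu -> gradient_gibbs d Q l' nu.
Proof.
move=> gibbs L w zeta Lconn; rewrite (gibbs L w zeta Lconn); congr EFin.
pose h (sigma : {ffun L -> 'Z_q}) : {ffun L -> 'Z_q} := [ffun v => sigma v + a].
have h_inj : injective h.
  move=> s r /ffunP sr; apply/ffunP => v; have := sr v.
  by rewrite !ffunE => /addIr.
rewrite (reindex_inj h_inj); apply: eq_bigr => sigma _; congr (_ * _).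
  rewrite /fuzzy_chain_law ffunE fuzzy_stationary_affine; congr (_ * _).
  by apply: eq_bigr => e _; rewrite !ffunE fuzzy_transition_affine.
apply: eq_bigr => e _; rewrite !ffunE; congr increment_law.
by rewrite opprD addrACA subrr addr0.
Qed.

End affine_change.

(** The remainder of a period modulo the minimal one is again a period. *)
Lemma minimal_period_dvd (R : realType) (lam : int -> R) (q m : nat) :
  minimal_period lam q -> periodic lam m -> (q %| m)%N.
Proof.
case=> q0 perq minq perm; rewrite /dvdn; apply/eqP.
have [//|r0] := posnP (m %% q); have : (q <= m %% q)%N.
  apply: minq => // i; rewrite -(periodic_mul (i + _) (m %/ q)%:Z perq).
  rewrite -addrA -PoszM -PoszD mulnC addnC -divn_eq; exact: perm.
by rewrite leqNgt ltn_pmod.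
Qed.

(** * Identification of the period *)

Section identification.
Context {R : realType} {V : choiceType} (adj : rel V) (b : nat -> V).
Hypothesis irr_adj : irreflexive adj.
Hypothesis sym_adj : symmetric adj.
Hypothesis acyc : acyclic_graph adj.
Hypothesis bP : infinite_path adj b.
Context (d : nat) (Q : int -> R).
Hypothesis d_gt0 : (0 < d)%N.
Hypothesis Q_transfer : transfer_operator Q.

Lemma ae_ex (nu : probability (gradient_space adj) R) (P : gradient_space adj -> Prop) :
  {ae nu, forall eta, P eta} -> exists eta, P eta.
Proof.
move=> aeP; apply: (@filter_ex _ (almost_everywhere nu)) aeP.
apply: ae_properfilter_algebraOfSetsType.
by apply: (@lt_le_trans _ _ 1%E); rewrite ?lte_fin// -(@probability_setT _ _ _ nu).
Qed.

Lemma ae_eq_measure (nu nu' : probability (gradient_space adj) R)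
    (P : gradient_space adj -> Prop) :
  (forall A, measurable A -> nu' A = nu A) ->
  {ae nu', forall eta, P eta} -> {ae nu, forall eta, P eta}.
Proof.
by move=> nuE [A [mA A0 PA]]; exists A; split=> //; rewrite -A0 nuE.
Qed.

Lemma boundary_law_gt0 (m : nat) (l : 'Z_m -> R) :
  periodic_boundary_law d Q m (unfold_Z l) -> forall s, 0 < l s.
Proof. by case=> _ + _ s => /(_ (val s)%:Z); rewrite /unfold_Z natr_residue. Qed.

Lemma powR_injective (p x y : R) : 0 < p -> 0 < x -> 0 < y ->
  x `^ p = y `^ p -> x = y.
Proof.
move=> p0 x0 y0 /(congr1 (fun z => z `^ p^-1)).
by rewrite -!powRrM mulfV ?gt_eqF// !powRr1 ?ltW.
Qed.

(** Two boundary laws with the same gradient Gibbs measure produce the same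
    empirical frequencies modulo a common multiple of their periods, and these
    frequencies determine each law up to a shift and a constant. *)
Lemma gibbs_common_period (q m : nat) (l : 'Z_q -> R) (l' : 'Z_m -> R)
    (nu nu' : probability (gradient_space adj) R) :
  (1 < q)%N -> (1 < m)%N ->
  periodic_boundary_law d Q q (unfold_Z l) ->
  periodic_boundary_law d Q m (unfold_Z l') ->
  gradient_gibbs d Q l nu -> gradient_gibbs d Q l' nu' ->
  (forall A, measurable A -> nu' A = nu A) ->
  periodic (unfold_Z l) m.
Proof.
move=> q1 m1 law law' gibbs gibbs' nuE.
have M1 : (1 < q * m)%N by rewrite (leq_trans q1)// leq_pmulr// ltnW.
have core := empirical_orbit_cvg irr_adj sym_adj acyc bP d_gt0 Q_transfer
  q1 law gibbs M1 (dvdn_mulr m (dvdnn q)) 0 0.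
have core' := empirical_orbit_cvg irr_adj sym_adj acyc bP d_gt0 Q_transfer
  m1 law' gibbs' M1 (dvdn_mull q (dvdnn m)) 0 0.
have [eta [cvg cvg']] := ae_ex (filterI core (ae_eq_measure nuE core')).
have [a eqa] := orbit_cvg_unique cvg cvg'.
have {}eqa (i : int) : fuzzy_stationary d (fold_Z (q * m) (unfold_Z l)) i%:~R =
    fuzzy_stationary d (fold_Z (q * m) (unfold_Z l')) (i + (val a)%:Z)%:~R.
  by have := eqa i%:~R; rewrite !stationary_simplexE intrD natr_residue.
have foldE : unfold_Z (fold_Z (q * m) (unfold_Z l)) = unfold_Z l.
  by apply: unfold_fold => //; exact: dvdn_mulr.
have foldE' : unfold_Z (fold_Z (q * m) (unfold_Z l')) = unfold_Z l'.
  by apply: unfold_fold => //; exact: dvdn_mull.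
have statE (l0 : 'Z_(q * m) -> R) (i : int) : fuzzy_stationary d l0 i%:~R =
  unfold_Z l0 i `^ (d.+1%:R / d%:R) / \sum_j l0 j `^ (d.+1%:R / d%:R) by [].
move=> i; apply: (@powR_injective (d.+1%:R / d%:R)).
- by rewrite divr_gt0 ?ltr0n.
- exact: (boundary_law_gt0 law).
- exact: (boundary_law_gt0 law).
have := eqa (i + m%:Z); rewrite [RHS]statE foldE' addrAC.
rewrite (periodic_unfold l' m1) -{1}foldE' -statE.
rewrite -eqa !statE foldE.
apply: mulIf; rewrite invr_eq0 gt_eqF// (bigD1 0)//= ltr_pwDl//.
  by rewrite powR_gt0// /fold_Z; exact: (boundary_law_gt0 law).
by apply: sumr_ge0 => j _; rewrite powR_ge0.
Qed.

End identification.

Theorem corollary1 (R : realType) (V : choiceType) (adj : rel V) (d : nat)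
    (Q : int -> R) (q : nat) (lam : 'Z_q -> R)
    (nu : probability (gradient_space adj) R)
    (b : nat -> V) (k : nat) (h : int) :
  cayley_tree adj d -> (2 <= d)%N -> transfer_operator Q -> (2 <= q)%N ->
  periodic_boundary_law d Q q (unfold_Z lam) -> minimal_period (unfold_Z lam) q ->
  gradient_gibbs d Q lam nu ->
  infinite_path adj b ->
  (forall m, (2 <= m)%N -> exists u : cyclic_simplex R m, empirical_limit nu b k h u) /\
  (forall alpha : (forall m, simplex R m),
     (forall m, (2 <= m)%N -> empirical_limit nu b k h (cyclic_class (alpha m))) ->
     is_gcd
       [set m | [/\ (2 <= m)%N,
          periodic_boundary_law d Q m (unfold_Z (tilde_law d (alpha m))) &
          exists2 nu' : probability (gradient_space adj) R,
            gradient_gibbs d Q (tilde_law d (alpha m)) nu' &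
            forall A, measurable A -> nu' A = nu A]]
       q).
Proof.
case=> irr sym _ _ [acyc _] d2 HQ q2 law minq gibbs bP.
have d0 : (0 < d)%N by exact: ltnW.
have core := empirical_orbit_cvg irr sym acyc bP d0 HQ q2 law gibbs.
split=> [m m2|alpha alphaP].
  have M1 : (1 < q * m)%N by rewrite (leq_trans q2)// leq_pmulr// ltnW.
  have qM := dvdn_mulr m (dvdnn q); have mM := dvdn_mull q (dvdnn m).
  eexists (cyclic_class (reduce_simplex _ _)).
  have := core _ M1 qM k h; apply: filterS => eta cvg.
  by apply/cvg_cyclic_classP; exact: orbit_cvg_reduce cvg.
split=> [m [m2 lawm [nu' gibbs' nuE]]|c cdiv].
  apply: minimal_period_dvd minq _.
  exact: (gibbs_common_period irr sym acyc bP d0 HQ q2 m2 law lawm gibbs gibbs' nuE).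
apply: cdiv => /=.
have l0 := boundary_law_gt0 law.
have [a alphaE] : exists a : 'Z_q, forall s : 'Z_q,
    set_val (alpha q) 0 s = fuzzy_stationary d lam (s + a).
  have [eta [cvg1 /cvg_cyclic_classP cvg2]] :=
    ae_ex (filterI (core q q2 (dvdnn q) k h) (alphaP q q2)).
  have [a eqa] := orbit_cvg_unique cvg2 cvg1; exists a => s.
  by rewrite eqa stationary_simplexE unfold_ZK.
pose Z := \sum_j lam j `^ (d.+1%:R / d%:R).
have Z0 : 0 < Z.
  rewrite /Z (bigD1 0)//= ltr_pwDl ?powR_gt0//.
  by apply: sumr_ge0 => j _; rewrite powR_ge0.
pose K := Z^-1 `^ (d%:R / d.+1%:R).
have K0 : 0 < K by rewrite powR_gt0 ?invr_gt0.
have -> : tilde_law d (alpha q) = fun s => K * lam (s + a).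
  apply/funext => s; rewrite /tilde_law alphaE /fuzzy_stationary -/Z mulrC.
  rewrite powRM ?invr_ge0 ?powR_ge0 ?(ltW Z0)// -powRrM; congr (_ * _).
  have -> : d.+1%:R / d%:R * (d%:R / d.+1%:R) = 1 :> R.
    by rewrite mulrA divfK ?divff ?pnatr_eq0 -?lt0n.
  by rewrite powRr1 ?ltW.
split=> //; first exact: boundary_law_affine.
by exists nu => //; exact: gradient_gibbs_affine.
Qed.
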